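(* Let $b>0$ and let $f\in C^2[-b,b]$ be complex-valued with $f(x)\ne0$ on $[-b,b]$ and $f(0)=1$. The integral kernels $\mathbf{K}_f$ and $\mathbf{K}_{1/f}$ of the transmutation operators $T_f$ and $T_{1/f}$ (defined in the context) are related, for $|t|\le|x|\le b$, by $$\mathbf{K}_{1/f}(x,t)=-\frac1{f(x)}\int_0^xf(\eta)\,\partial_t\mathbf{K}_f(\eta,0)\,d\eta-\int_0^t\partial_x\mathbf{K}_f(x,\xi)\,d\xi+\frac{f'(x)}{f(x)}\int_0^t\mathbf{K}_f(x,\xi)\,d\xi-\frac{f'(0)}{2f(x)}$$ and $$\mathbf{K}_f(x,t)=-f(x)\int_0^x\frac1{f(\eta)}\,\partial_t\mathbf{K}_{1/f}(\eta,0)\,d\eta-\int_0^t\partial_x\mathbf{K}_{1/f}(x,\xi)\,d\xi-\frac{f'(x)}{f(x)}\int_0^t\mathbf{K}_{1/f}(x,\xi)\,d\xi+\frac{f'(0)}2f(x).$$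
   Context: For a complex-valued $q\in C[-b,b]$ and $h\in\mathbb{C}$, let $\mathbf{H}(u,v;h)$ be the unique solution, on $\{(u,v):|u|\le b,|v|\le b,|u+v|\le b\}$, of the Goursat problem $$\frac{\partial^2\mathbf{H}(u,v;h)}{\partial u\,\partial v}=q(u+v)\mathbf{H}(u,v;h),\qquad \mathbf{H}(u,0;h)=\frac h2+\frac12\int_0^uq(s)\,ds,\qquad \mathbf{H}(0,v;h)=\frac h2,$$ let $\mathbf{K}(x,t;h)=\mathbf{H}\bigl(\frac{x+t}2,\frac{x-t}2;h\bigr)$, and let $\mathbf{T}_hu(x)=u(x)+\int_{-x}^x\mathbf{K}(x,t;h)u(t)\,dt$. $T_f$ (kernel $\mathbf{K}_f$) is $\mathbf{T}_h$ for the potential $q=q_f:=f''/f$ and $h=f'(0)$; $T_{1/f}$ (kernel $\mathbf{K}_{1/f}$) is $\mathbf{T}_h$ for the potential $q=q_{1/f}:=-q_f+2(f'/f)^2$ and $h=-f'(0)$. *)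

(* Defs.v *)
From Stdlib Require Import Reals.
From Coquelicot Require Import Coquelicot.
Open Scope R_scope.

(* Derivatives at x of C-valued functions of a real variable, relative to a set
   D: at an endpoint of an interval D this is the one-sided derivative, at an
   interior point it is the usual [is_derive]. *)
Definition is_derive_on (D : R -> Prop) (g : R -> C) (x : R) (l : C) : Prop :=
  @filterdiff R_AbsRing R_NormedModule C_R_NormedModule
    g (within D (locally x)) (fun y : R => scal y l).

Definition ex_derive_on (D : R -> Prop) (g : R -> C) (x : R) : Prop :=
  exists l : C, is_derive_on D g x l.

(* Total version, in the style of [RInt]: meaningful when the derivative exists
   and x is an accumulation point of D. *)
Definition Derive_on (D : R -> Prop) (g : R -> C) (x : R) : C :=
  @iota C_R_CompleteNormedModule (is_derive_on D g x).

Definition CInt (g : R -> C) (a c : R) : C :=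
  @RInt C_R_CompleteNormedModule g a c.

(* Partial derivatives relative to the slices of a planar domain. *)
Definition partial1 (D : R -> R -> Prop) (F : R -> R -> C) (x y : R) : C :=
  Derive_on (fun s => D s y) (fun s => F s y) x.

Definition partial2 (D : R -> R -> Prop) (F : R -> R -> C) (x y : R) : C :=
  Derive_on (fun s => D x s) (fun s => F x s) y.

Definition sym_itv (b : R) (x : R) : Prop := - b <= x <= b.

Definition C2_on (D : R -> Prop) (f : R -> C) : Prop :=
  (forall x, D x -> ex_derive_on D f x) /\
  (forall x, D x -> ex_derive_on D (Derive_on D f) x) /\
  @continuous_on R_UniformSpace C_R_NormedModule D
    (Derive_on D (Derive_on D f)).

Definition goursat_dom (b u v : R) : Prop :=
  Rabs u <= b /\ Rabs v <= b /\ Rabs (u + v) <= b.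

(* Since q is only continuous, H need not have second derivatives in u alone;
   a solution is a continuous function for which d/du (d/dv H) exists and
   satisfies the equation at each point of the closed domain. *)
Record goursat_solution (b : R) (q : R -> C) (h : C) (H : R -> R -> C) : Prop :=
  { goursat_continuous :
      @continuous_on (prod_UniformSpace R_UniformSpace R_UniformSpace)
        C_R_NormedModule
        (fun p => goursat_dom b (fst p) (snd p)) (fun p => H (fst p) (snd p));
    goursat_ex_dv : forall u v : R, goursat_dom b u v ->
      ex_derive_on (fun s => goursat_dom b u s) (fun s => H u s) v;
    goursat_eq : forall u v : R, goursat_dom b u v ->
      is_derive_on (fun s => goursat_dom b s v)
        (fun s => partial2 (goursat_dom b) H s v) u
        (q (u + v)%R * H u v)%C;
    goursat_u_axis : forall u : R, sym_itv b u ->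
      H u 0 = (h / 2 + / 2 * CInt q 0 u)%C;
    goursat_v_axis : forall v : R, sym_itv b v ->
      H 0 v = (h / 2)%C }.

Definition kernel_of (H : R -> R -> C) (x t : R) : C :=
  H ((x + t) / 2) ((x - t) / 2).

(* The set of (x, t) for which [kernel_of H x t] evaluates H inside its domain;
   it contains the set |t| <= |x| <= b. *)
Definition kernel_dom (b x t : R) : Prop :=
  goursat_dom b ((x + t) / 2) ((x - t) / 2).

(* K is the kernel of T_h u(x) = u(x) + \int_{-x}^x K(x, t) u(t) dt. *)
Definition transmutation_kernel
    (b : R) (q : R -> C) (h : C) (K : R -> R -> C) : Prop :=
  exists H : R -> R -> C, goursat_solution b q h H /\
    forall x t : R, kernel_dom b x t -> K x t = kernel_of H x t.

Definition q_f (b : R) (f : R -> C) (x : R) : C :=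
  (Derive_on (sym_itv b) (Derive_on (sym_itv b) f) x / f x)%C.

Definition q_inv_f (b : R) (f : R -> C) (x : R) : C :=
  let f' := Derive_on (sym_itv b) f in
  (- q_f b f x + 2 * ((f' x / f x) * (f' x / f x)))%C.

Definition is_kernel_f (b : R) (f : R -> C) (K : R -> R -> C) : Prop :=
  transmutation_kernel b (q_f b f) (Derive_on (sym_itv b) f 0) K.

Definition is_kernel_inv_f (b : R) (f : R -> C) (K : R -> R -> C) : Prop :=
  transmutation_kernel b (q_inv_f b f) (- Derive_on (sym_itv b) f 0)%C K.

(* Main.v *)
Require Import Defs.
From Stdlib Require Import Reals Lra.
From Coquelicot Require Import Coquelicot.
Open Scope R_scope.

(** Write a = f'/f, so that q_f = a' + a^2 and q_(1/f) = a^2 - a', and let K and G be the solutions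
    of the Goursat problems for f and for 1/f, in the characteristic coordinates u = (x+t)/2,
    v = (x-t)/2.  Both formulas of the theorem are integrated forms of the single first-order
    (Darboux, or Cauchy-Riemann-like) system

      G_x + a G = - K_t,      G_t = - K_x + a K,

    which in characteristic coordinates says that the two expressions

      P = (G + K)_u + a (G - K),      Q = (G - K)_v + a (G + K),      a = a(u + v),

    vanish identically.  They do vanish, because the two Goursat equations imply P_v = a Q and
    Q_u = a P, while the data on the axes give P(u,0) = 0 and Q(0,v) = 0; a Gronwall argument with
    exponential weights ([goursat_system_zero]) then forces P = Q = 0 ([darboux_system]).

    Given the system, G(x,t) is recovered from its derivative in t and from the derivative of
    f G along the x-axis, (f G)_x = - f K_t ([kernel_reconstruction]).  The system is invariant under
    exchanging (G, a, f) with (K, -a, 1/f), and this exchange turns the first formula into the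
    second.

    The remaining difficulty is regularity.  A solution of the Goursat problem is only assumed to
    have the iterated derivative H_vu, and all derivatives are one-sided at the boundary of the
    hexagonal domain.  Integrating the equation twice expresses H on the hexagon through
    h/2 + (1/2) int_0^u q + int_0^v int_0^u q H.  Extending the continuous integrands q and q H to
    the whole line and plane by retractions makes this expression a C^1 function on the whole
    plane that agrees with H on the hexagon ([goursat_regular]).  From there on, only ordinary
    two-sided derivatives occur.  The function a is extended from [-b,b] to the line in the same
    way ([log_derivative_extension]). *)

Local Notation is_Cderive := (@is_derive R_AbsRing C_R_NormedModule).
Local Notation Ccontinuous := (@continuous R_UniformSpace C_R_NormedModule).
Local Notation R2 := (prod_UniformSpace R_UniformSpace R_UniformSpace).

(** * Calculus of complex-valued functions of a real variable *)

(** Derivatives and continuity of complex functions are reduced to real and imaginary parts,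
    because the product rules and the theorems on parametric integrals concern values in an
    absolute-value ring or in R, whereas C is only a normed module over R here. *)
Lemma is_Cderive_parts (F : R -> C) (x : R) (l : C) :
  is_Cderive F x l <->
  is_derive (fun s => Re (F s)) x (Re l) /\ is_derive (fun s => Im (F s)) x (Im l).
Proof.
  split.
  - intros H; split.
    + apply (filterdiff_comp' F (fst : C_R_NormedModule -> R_NormedModule) x
               (fun y : R => scal y l) fst H).
      apply filterdiff_linear, is_linear_fst.
    + apply (filterdiff_comp' F (snd : C_R_NormedModule -> R_NormedModule) x
               (fun y : R => scal y l) snd H).
      apply filterdiff_linear, is_linear_snd.
  - intros [H1 H2].
    assert (H3 := filterdiff_comp'_2 (K := R_AbsRing) (W := C_R_NormedModule)
      _ _ (fun a b : R => (a, b)) x _ _ (fun a b : R => (a, b)) H1 H2).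
    assert (H4 : filterdiff (K := R_AbsRing) (U := C_R_NormedModule) (V := C_R_NormedModule)
      (fun t : C => (fst t, snd t)) (locally (Re (F x), Im (F x))) (fun t : C => (fst t, snd t))).
    { apply (filterdiff_ext_lin (U := C_R_NormedModule) (V := C_R_NormedModule)
        _ (fun t : C => t)).
      - apply (filterdiff_ext (U := C_R_NormedModule) (V := C_R_NormedModule) (fun t : C => t)).
        + intros y; apply surjective_pairing.
        + apply (filterdiff_id (V := C_R_NormedModule)).
      - intros y; apply surjective_pairing. }
    specialize (H3 H4).
    apply (filterdiff_ext_lin (U := R_NormedModule) (V := C_R_NormedModule)
             _ (fun y : R => (scal y (Re l), scal y (Im l)))); [|reflexivity].
    apply (filterdiff_ext (U := R_NormedModule) (V := C_R_NormedModule)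
             (fun y : R => (Re (F y), Im (F y)))); [|exact H3].
    intros y; symmetry; apply surjective_pairing.
Qed.

Lemma Ccontinuous_parts (T : UniformSpace) (F : T -> C) (x : T) :
  @continuous T C_R_NormedModule F x <->
  continuous (fun s => Re (F s)) x /\ continuous (fun s => Im (F s)) x.
Proof.
  split.
  - intros H; split.
    + apply (continuous_comp F (fst : C -> R) x H).
      destruct (F x). apply (continuous_fst (U := R_UniformSpace)).
    + apply (continuous_comp F (snd : C -> R) x H).
      destruct (F x). apply (continuous_snd (U := R_UniformSpace)).
  - intros [H1 H2].
    apply (continuous_ext (fun s => (Re (F s), Im (F s)))).
    { intros s; symmetry; apply surjective_pairing. }
    apply (continuous_comp_2 (X := C_R_NormedModule) _ _ (fun a b : R => (a, b)) x H1 H2).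
    apply (continuous_ext (fun t : C => t)).
    { intros s; apply surjective_pairing. }
    apply continuous_id.
Qed.

Lemma Ccontinuous_mult (T : UniformSpace) (F G : T -> C) (x : T) :
  @continuous T C_R_NormedModule F x -> @continuous T C_R_NormedModule G x ->
  @continuous T C_R_NormedModule (fun s => F s * G s)%C x.
Proof.
  intros HF HG; apply Ccontinuous_parts in HF, HG; apply Ccontinuous_parts.
  destruct HF as [F1 F2], HG as [G1 G2]; split.
  - apply (continuous_minus (fun s => Re (F s) * Re (G s)) (fun s => Im (F s) * Im (G s)));
      apply (continuous_mult (K := R_AbsRing)); assumption.
  - apply (continuous_plus (fun s => Re (F s) * Im (G s)) (fun s => Im (F s) * Re (G s)));
      apply (continuous_mult (K := R_AbsRing)); assumption.
Qed.

Lemma is_Cderive_eq (F : R -> C) (x : R) (l l' : C) :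
  is_Cderive F x l -> l = l' -> is_Cderive F x l'.
Proof. now intros H <-. Qed.

Lemma is_Cderive_mult (F G : R -> C) (x : R) (dF dG : C) :
  is_Cderive F x dF -> is_Cderive G x dG ->
  is_Cderive (fun s => F s * G s)%C x (dF * G x + F x * dG)%C.
Proof.
  intros HF HG; apply is_Cderive_parts in HF, HG; apply is_Cderive_parts.
  destruct HF as [F1 F2], HG as [G1 G2]; split; cbn -[Re Im].
  - evar_last.
    + apply (is_derive_minus (fun s => Re (F s) * Re (G s)) (fun s => Im (F s) * Im (G s)));
        apply (is_derive_mult (K := R_AbsRing)); try eassumption; exact Rmult_comm.
    + unfold minus, plus, opp, mult; simpl; unfold Re, Im; ring.
  - evar_last.
    + apply (is_derive_plus (fun s => Re (F s) * Im (G s)) (fun s => Im (F s) * Re (G s)));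
        apply (is_derive_mult (K := R_AbsRing)); try eassumption; exact Rmult_comm.
    + unfold minus, plus, opp, mult; simpl; unfold Re, Im; ring.
Qed.

Lemma Re2_Im2_pos (z : C) : z <> 0%C -> 0 < Re z ^ 2 + Im z ^ 2.
Proof.
  intros Hz. destruct (Req_dec (Re z) 0) as [E1|E1]; [destruct (Req_dec (Im z) 0) as [E2|E2]|].
  - exfalso; apply Hz; destruct z; unfold Re, Im in *; simpl in *; subst; reflexivity.
  - nra.
  - nra.
Qed.

Lemma is_Cderive_inv (F : R -> C) (x : R) (dF : C) :
  is_Cderive F x dF -> F x <> 0%C ->
  is_Cderive (fun s => / F s)%C x (- dF / (F x * F x))%C.
Proof.
  intros HF Hn; assert (Hp := Re2_Im2_pos _ Hn).
  apply is_Cderive_parts in HF; apply is_Cderive_parts; destruct HF as [F1 F2].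
  assert (HN : is_derive (fun s => Re (F s) ^ 2 + Im (F s) ^ 2) x
     (2 * Re (F x) * Re dF + 2 * Im (F x) * Im dF)).
  { evar_last.
    - apply (is_derive_plus (fun s => Re (F s) ^ 2) (fun s => Im (F s) ^ 2));
        apply is_derive_pow; eassumption.
    - unfold plus; simpl; ring. }
  assert (Hp' : Re (F x) * Re (F x) + Im (F x) * Im (F x) <> 0) by (simpl in Hp; nra).
  (* The squared modulus of (F x)^2, which is the denominator of the stated derivative. *)
  assert (Hq : (Re (F x) * Re (F x) - Im (F x) * Im (F x)) ^ 2
               + (Re (F x) * Im (F x) + Im (F x) * Re (F x)) ^ 2 <> 0).
  { replace (_ + _) with ((Re (F x) * Re (F x) + Im (F x) * Im (F x)) ^ 2) by ring.
    apply pow_nonzero, Hp'. }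
  split.
  - evar_last.
    + apply (is_derive_div (fun s => Re (F s)) (fun s => Re (F s) ^ 2 + Im (F s) ^ 2));
        try eassumption; lra.
    + destruct (F x) as [p q], dF as [p' q'].
      unfold Re, Im, Cdiv, Cinv, Cmult, Copp in *; simpl in *; field.
      split; [rewrite !Rmult_1_r in Hq; exact Hq | exact Hp'].
  - evar_last.
    + apply (is_derive_div (fun s => - Im (F s)) (fun s => Re (F s) ^ 2 + Im (F s) ^ 2));
        try eassumption; try lra.
      apply (is_derive_opp (fun s => Im (F s)) x (Im dF) F2 : is_derive _ x (- Im dF)).
    + destruct (F x) as [p q], dF as [p' q'].
      unfold Re, Im, Cdiv, Cinv, Cmult, Copp in *; simpl in *; field.
      split; [rewrite !Rmult_1_r in Hq; exact Hq | exact Hp'].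
Qed.

Lemma is_Cderive_continuous (F : R -> C) (x : R) (l : C) :
  is_Cderive F x l -> Ccontinuous F x.
Proof. intros H; apply (ex_derive_continuous (V := C_R_NormedModule)); eexists; exact H. Qed.

Lemma is_Cderive_pair (h k : R -> R) (x l m : R) :
  is_derive h x l -> is_derive k x m -> is_Cderive (fun s => (h s, k s)) x (l, m).
Proof. intros; apply is_Cderive_parts; split; assumption. Qed.

Lemma is_Cderive_const (z : C) (x : R) : is_Cderive (fun _ => z) x (RtoC 0).
Proof. exact (is_derive_const (V := C_R_NormedModule) z x). Qed.

Lemma is_Cderive_plus (F G : R -> C) (x : R) (dF dG : C) :
  is_Cderive F x dF -> is_Cderive G x dG -> is_Cderive (fun s => F s + G s)%C x (dF + dG)%C.
Proof. exact (is_derive_plus (V := C_R_NormedModule) F G x dF dG). Qed.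

Lemma is_Cderive_minus (F G : R -> C) (x : R) (dF dG : C) :
  is_Cderive F x dF -> is_Cderive G x dG -> is_Cderive (fun s => F s - G s)%C x (dF - dG)%C.
Proof. exact (is_derive_minus (V := C_R_NormedModule) F G x dF dG). Qed.

Lemma is_Cderive_CInt (h : R -> C) (c x : R) :
  (forall s, Ccontinuous h s) -> is_Cderive (fun y => CInt h c y) x (h x).
Proof.
  intros Hh; apply (is_derive_RInt (V := C_R_NormedModule) h _ c).
  - apply filter_forall; intros y; apply (RInt_correct (V := C_R_CompleteNormedModule) h).
    apply (ex_RInt_continuous (V := C_R_CompleteNormedModule)); intros; apply Hh.
  - apply Hh.
Qed.

Lemma CInt_ext (h k : R -> C) (c x : R) :
  (forall s, Rmin c x < s < Rmax c x -> h s = k s) -> CInt h c x = CInt k c x.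
Proof. exact (RInt_ext (V := C_R_CompleteNormedModule) h k c x). Qed.

Lemma CInt_point (h : R -> C) (c : R) : CInt h c c = RtoC 0.
Proof. exact (RInt_point (V := C_R_CompleteNormedModule) c h). Qed.

(** * Derivatives relative to an interval *)

Lemma within_ProperFilter (T : UniformSpace) (D : T -> Prop) (x : T) :
  D x -> ProperFilter (within D (locally x)).
Proof.
  intros Hx; constructor; [|apply within_filter, locally_filter].
  intros P HP; exists x; apply (locally_singleton _ _ HP), Hx.
Qed.

Lemma within_is_filter_lim (T : UniformSpace) (D : T -> Prop) (x : T) :
  is_filter_lim (within D (locally x)) x.
Proof. intros P HP; unfold within; revert HP; apply filter_imp; intros; assumption. Qed.

Lemma is_derive_on_ext (D : R -> Prop) (g F : R -> C) (x : R) (l : C) :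
  D x -> (forall y, D y -> g y = F y) -> is_derive_on D F x l -> is_derive_on D g x l.
Proof.
  intros Hx He HF.
  assert (HP := within_ProperFilter _ _ _ Hx : ProperFilter (within D (@locally R_NormedModule
    x))).
  apply (filterdiff_ext_loc (U := R_NormedModule) F); trivial.
  - unfold within; apply filter_forall; intros y Hy; symmetry; apply He, Hy.
  - intros z Hz.
    assert (E := is_filter_lim_unique (V := R_NormedModule) x z
                   (within_is_filter_lim R_UniformSpace D x) Hz).
    subst z; symmetry; apply He, Hx.
Qed.

Lemma is_derive_on_of_is_derive (D : R -> Prop) (g F : R -> C) (x : R) (l : C) :
  D x -> (forall y, D y -> g y = F y) -> is_Cderive F x l -> is_derive_on D g x l.
Proof.
  intros Hx He HF; apply (is_derive_on_ext D g F); trivial.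
  apply (filterdiff_locally (U := R_NormedModule) (FF := within_ProperFilter _ _ _ Hx) _ x);
    trivial.
  apply (within_is_filter_lim R_UniformSpace).
Qed.

Lemma is_derive_on_minus (D : R -> Prop) (g F : R -> C) (x : R) (l m : C) :
  is_derive_on D g x l -> is_derive_on D F x m ->
  is_derive_on D (fun y => g y - F y)%C x (l - m)%C.
Proof.
  intros Hg HF.
  apply (filterdiff_ext_lin (U := R_NormedModule) (V := C_R_NormedModule) _
    (fun y : R => minus (scal y l) (scal y m))).
  - exact (filterdiff_minus_fct (U := R_NormedModule) (V := C_R_NormedModule) _ _ _ _ Hg HF).
  - intros y; symmetry; apply (scal_minus_distr_l (V := C_R_NormedModule) y l m).
Qed.

Lemma is_derive_on_continuous_on (D : R -> Prop) (g : R -> C) :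
  (forall x, D x -> ex_derive_on D g x) ->
  @continuous_on R_UniformSpace C_R_NormedModule D g.
Proof.
  intros H x Hx; destruct (H x Hx) as [l Hl].
  apply (filterdiff_continuous_aux (U := R_NormedModule) (V := C_R_NormedModule)).
  - eexists; exact Hl.
  - apply (within_is_filter_lim R_UniformSpace).
Qed.

Lemma is_derive_on_interior (D : R -> Prop) (g : R -> C) (x : R) (l : C) :
  locally x D -> is_derive_on D g x l -> is_Cderive g x l.
Proof.
  intros HD [H1 H2]; split; trivial.
  intros z Hz eps.
  assert (x = z) as <- by apply (is_filter_lim_locally_unique (V := R_NormedModule) _ _ Hz).
  assert (H3 := H2 x (within_is_filter_lim R_UniformSpace D x) eps).
  unfold within in H3.
  generalize (filter_and _ _ HD H3); apply filter_imp; intros y [Ha Hb]; exact (Hb Ha).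
Qed.

Definition convex_set (D : R -> Prop) : Prop :=
  forall x y z, D x -> D y -> x <= z <= y -> D z.

(** A convex set with a second point z contains the segment from x to z, so x is one of its
    accumulation points; there the difference of two derivatives is a slope of the zero function. *)
Lemma is_derive_on_unique (D : R -> Prop) (g : R -> C) (x z : R) (l m : C) :
  convex_set D -> D x -> D z -> z <> x ->
  is_derive_on D g x l -> is_derive_on D g x m -> l = m.
Proof.
  intros HC Hx Hz Hzx Hl Hm.
  assert (H0 := is_derive_on_minus _ _ _ _ _ _ Hl Hm).
  assert (H1 : is_derive_on D (fun _ => 0%C) x (l - m)%C).
  { apply (is_derive_on_ext D _ (fun y => g y - g y)%C); trivial.
    intros y _; ring. }
  assert (l - m = 0)%C as E; [|replace l with (l - m + m)%C by ring; rewrite E; ring].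
  apply (norm_eq_zero (V := C_R_NormedModule)), Rle_antisym; [|apply norm_ge_0].
  apply le_epsilon; intros eps Heps; rewrite Rplus_0_l.
  destruct H1 as [_ H1].
  specialize (H1 x (within_is_filter_lim R_UniformSpace D x) (mkposreal eps Heps)).
  destruct H1 as [d Hd].
  (* A point of the segment from x to z at distance at most d/2 from x. *)
  set (r := Rmin 1 (d / 2 / Rabs (z - x))).
  assert (Ha : 0 < Rabs (z - x)) by (apply Rabs_pos_lt; lra).
  assert (Hd0 := cond_pos d).
  assert (Hr0 : 0 < r).
  { apply Rmin_case; [lra|]. apply Rdiv_lt_0_compat; lra. }
  assert (Hr1 : r <= 1) by apply Rmin_l.
  assert (Hr2 : r * Rabs (z - x) <= d / 2).
  { apply Rle_trans with (d / 2 / Rabs (z - x) * Rabs (z - x)).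
    - apply Rmult_le_compat_r; [lra | apply Rmin_r].
    - right; field; lra. }
  set (y := x + r * (z - x)).
  assert (Hy : Rabs (y - x) = r * Rabs (z - x)).
  { unfold y; replace (x + r * (z - x) - x) with (r * (z - x)) by ring.
    rewrite Rabs_mult, (Rabs_pos_eq r); lra. }
  assert (HDy : D y).
  { destruct (Rle_dec x z); [apply (HC x z) | apply (HC z x)]; trivial; unfold y; split; nra. }
  assert (H2 := Hd y).
  refine (_ (H2 _ HDy)).
  2:{ change (Rabs (y - x) < d). rewrite Hy; lra. }
  simpl. intros H3.
  assert (H4 : @norm R_AbsRing R_NormedModule (minus y x) = r * Rabs (z - x)) by exact Hy.
  assert (Hr3 : 0 < r * Rabs (z - x)) by (apply Rmult_lt_0_compat; lra).
  assert (Hy0 : y - x <> 0) by (intros E; rewrite E, Rabs_R0 in Hy; lra).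
  assert (H5 : @norm R_AbsRing C_R_NormedModule (l - m)%C
    <= / (r * Rabs (z - x)) * @norm R_AbsRing C_R_NormedModule
         (scal (y - x : R) ((l - m)%C : C_R_NormedModule))).
  { replace (/ (r * Rabs (z - x))) with (Rabs (/ (y - x))) by (rewrite Rabs_inv, Hy; trivial).
    eapply Rle_trans; [|apply (norm_scal (V := C_R_NormedModule))].
    right; apply f_equal; rewrite (scal_assoc (V := C_R_NormedModule)).
    unfold mult; simpl; rewrite Rinv_l by trivial.
    symmetry; apply (scal_one (V := C_R_NormedModule)). }
  assert (H6 : @norm R_AbsRing C_R_NormedModule (scal (y - x : R) ((l - m)%C : C_R_NormedModule))
    <= eps * (r * Rabs (z - x))).
  { rewrite <- Hy. eapply Rle_trans; [|exact H3].
    right; rewrite minus_eq_zero.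
    unfold minus at 1; rewrite plus_zero_l, norm_opp; reflexivity. }
  eapply Rle_trans; [exact H5|].
  apply Rle_trans with (/ (r * Rabs (z - x)) * (eps * (r * Rabs (z - x)))).
  - apply Rmult_le_compat_l; trivial; apply Rlt_le, Rinv_0_lt_compat, Hr3.
  - right; field; split; lra.
Qed.

Lemma Derive_on_unique (D : R -> Prop) (g : R -> C) (x z : R) (l : C) :
  convex_set D -> D x -> D z -> z <> x ->
  is_derive_on D g x l -> Derive_on D g x = l.
Proof.
  intros; apply (iota_unique (V := C_R_CompleteNormedModule)); trivial.
  intros m Hm; now apply (is_derive_on_unique D g x z).
Qed.

(** Composing with a retraction onto D turns relative continuity on D into plain continuity. *)
Lemma continuous_on_retract (T U V : UniformSpace) (D : U -> Prop) (g : U -> V) (r : T ->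
  U) (x : T) :
  continuous_on D g -> (forall y, D (r y)) -> continuous r x ->
  continuous (fun y => g (r y)) x.
Proof.
  intros Hg HD Hr.
  apply (filterlim_comp _ _ _ r g _ (within D (locally (r x)))); [|apply Hg, HD].
  intros P HP; change (locally x (fun y => P (r y))).
  apply (filter_imp (fun y => D (r y) -> P (r y))); [|exact (Hr _ HP)].
  intros y Hy; apply Hy, HD.
Qed.

Definition clamp (p q s : R) : R := Rmax p (Rmin q s).

Lemma clamp_in (p q s : R) : p <= q -> p <= clamp p q s <= q.
Proof. intros; unfold clamp, Rmax, Rmin; repeat destruct Rle_dec; lra. Qed.

Lemma clamp_id (p q s : R) : p <= s <= q -> clamp p q s = s.
Proof. intros; unfold clamp, Rmax, Rmin; repeat destruct Rle_dec; lra. Qed.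

Lemma continuous_clamp (p q s : R) : continuous (clamp p q) s.
Proof.
  apply filterlim_locally; intros eps; exists eps; intros y Hy.
  change (Rabs (y - s) < eps) in Hy; change (Rabs (clamp p q y - clamp p q s) < eps).
  apply Rle_lt_trans with (2 := Hy).
  unfold clamp, Rmax, Rmin, Rabs; repeat destruct Rle_dec; repeat destruct Rcase_abs; lra.
Qed.

(** The mean value theorem needs continuity in a full neighbourhood of the end points, where g is
    known only on one side; clamping the argument to [x,y] supplies it. *)
Lemma constant_of_zero_derive_on (D : R -> Prop) (g : R -> C) (x y : R) :
  convex_set D -> (forall s, D s -> is_derive_on D g s (RtoC 0)) -> D x -> D y -> g x = g y.
Proof.
  intros HC H0.
  assert (Hlt : forall x y, x < y -> D x -> D y -> g x = g y).
  { clear x y; intros x y Hxy Hx Hy.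
    assert (Hsub : forall s, x <= s <= y -> D s) by (intros s; now apply HC).
    assert (Hcont : forall s, Ccontinuous (fun s => g (clamp x y s)) s).
    { intros s; apply (continuous_on_retract R_UniformSpace R_UniformSpace C_R_NormedModule D).
      - apply is_derive_on_continuous_on; intros z Hz; eexists; apply H0, Hz.
      - intros z; apply Hsub, clamp_in; lra.
      - apply continuous_clamp. }
    assert (Hder : forall s, x < s < y -> is_Cderive (fun s => g (clamp x y s)) s (RtoC 0)).
    { intros s Hs.
      assert (Hloc : locally s (fun t => x < t < y)).
      { apply (open_and (fun t => x < t) (fun t => t < y));
          [apply open_gt | apply open_lt | exact Hs]. }
      apply (is_derive_ext_loc (V := C_R_NormedModule) g).
      - revert Hloc; apply filter_imp; intros t Ht; rewrite clamp_id; trivial; lra.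
      - apply (is_derive_on_interior D).
        + revert Hloc; apply filter_imp; intros t Ht; apply Hsub; lra.
        + apply H0, Hsub; lra. }
    assert (Hpart : forall p : C -> R,
       (forall s, continuous (fun s => p (g (clamp x y s))) s) ->
       (forall s, x < s < y -> is_derive (fun s => p (g (clamp x y s))) s 0) ->
       p (g x) = p (g y)).
    { intros p Hc Hd.
      destruct (MVT_gen (fun s => p (g (clamp x y s))) x y (fun _ => 0)) as [c [_ Hc2]].
      - intros s; rewrite Rmin_left, Rmax_right by lra; apply Hd.
      - intros s _; apply continuity_pt_filterlim, Hc.
      - rewrite !clamp_id in Hc2 by lra. lra. }
    rewrite (surjective_pairing (g x)), (surjective_pairing (g y)); f_equal.
    - apply (Hpart fst).
      + intros s; exact (proj1 (proj1 (Ccontinuous_parts R_UniformSpace _ _) (Hcont s))).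
      + intros s Hs; exact (proj1 (proj1 (is_Cderive_parts _ _ _) (Hder s Hs))).
    - apply (Hpart snd).
      + intros s; exact (proj2 (proj1 (Ccontinuous_parts R_UniformSpace _ _) (Hcont s))).
      + intros s Hs; exact (proj2 (proj1 (is_Cderive_parts _ _ _) (Hder s Hs))). }
  intros Hx Hy; destruct (Rtotal_order x y) as [?|[->|?]]; auto.
  symmetry; auto.
Qed.

Lemma constant_of_zero_derive (F : R -> C) (x : R) :
  (forall s, Rmin 0 x <= s <= Rmax 0 x -> is_Cderive F s (RtoC 0)) -> F x = F 0.
Proof.
  intros H; apply (constant_of_zero_derive_on (fun s => Rmin 0 x <= s <= Rmax 0 x)).
  - intros y z w H1 H2 H3; lra.
  - intros s Hs; apply (is_derive_on_of_is_derive _ _ F); auto.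
  - unfold Rmin, Rmax; destruct Rle_dec; lra.
  - unfold Rmin, Rmax; destruct Rle_dec; lra.
Qed.

(** * Functions of two variables *)

Lemma continuity_2d_pt_slice1 (g : R -> R -> R) (u v : R) :
  continuity_2d_pt g u v -> continuous (fun s => g s v) u.
Proof.
  intros H; apply filterlim_locally; intros eps; destruct (H eps) as [d Hd].
  exists d; intros y Hy; apply Hd; [exact Hy|].
  rewrite Rminus_diag, Rabs_R0; apply cond_pos.
Qed.

Lemma continuity_2d_pt_swap (g : R -> R -> R) (u v : R) :
  continuity_2d_pt g u v -> continuity_2d_pt (fun s w => g w s) v u.
Proof. intros H eps; destruct (H eps) as [d Hd]; exists d; intros; now apply Hd. Qed.

Lemma continuity_2d_pt_slice2 (g : R -> R -> R) (u v : R) :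
  continuity_2d_pt g u v -> continuous (fun s => g u s) v.
Proof. intros H; apply (continuity_2d_pt_slice1 (fun s w => g w s)), continuity_2d_pt_swap,
  H. Qed.

Lemma is_derive_RInt_right (h : R -> R) (c x : R) :
  (forall s, continuous h s) -> is_derive (fun y => RInt h c y) x (h x).
Proof.
  intros Hh; apply (is_derive_RInt h _ c).
  - apply filter_forall; intros y; apply (RInt_correct h),
      (ex_RInt_continuous (V := R_CompleteNormedModule)); intros; apply Hh.
  - apply Hh.
Qed.

(** Uniform continuity of g on a rectangle controls the change of v; the change of u is controlled
    by the fundamental theorem at fixed v. *)
Lemma RInt_slice_continuity_2d (g : R -> R -> R) (u v : R) :
  (forall u v, continuity_2d_pt g u v) ->
  continuity_2d_pt (fun u v => RInt (fun s => g s v) 0 u) u v.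
Proof.
  intros Hg eps.
  assert (Hex : forall w p q, ex_RInt (fun s => g s w) p q).
  { intros w p q; apply (ex_RInt_continuous (V := R_CompleteNormedModule)); intros;
      apply continuity_2d_pt_slice1, Hg. }
  set (B := Rabs u + 1).
  assert (HB : 0 < B) by (unfold B; assert (H := Rabs_pos u); lra).
  assert (He : 0 < eps / 2 / B) by (apply Rdiv_lt_0_compat; [apply is_pos_div_2 | trivial]).
  destruct (uniform_continuity_2d g (-B) B (v - 1) (v + 1) ltac:(intros; apply Hg)
    (mkposreal _ He)) as [d1 Hd1].
  assert (Hc : continuous (fun y => RInt (fun s => g s v) 0 y) u).
  { apply (ex_derive_continuous (V := R_NormedModule)); eexists; apply is_derive_RInt_right.
    intros; apply continuity_2d_pt_slice1, Hg. }
  destruct (proj1 (filterlim_locally _ _) Hc (pos_div_2 eps)) as [d2 Hd2].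
  assert (Hd : 0 < Rmin 1 (Rmin d1 d2)).
  { repeat apply Rmin_case; [lra | apply cond_pos | apply cond_pos]. }
  exists (mkposreal _ Hd); simpl; intros y w Hy Hw.
  assert (H1 : Rmin 1 (Rmin d1 d2) <= 1) by apply Rmin_l.
  assert (H2 : Rmin 1 (Rmin d1 d2) <= Rmin d1 d2) by apply Rmin_r.
  assert (H3 : Rmin d1 d2 <= d1) by apply Rmin_l.
  assert (H4 : Rmin d1 d2 <= d2) by apply Rmin_r.
  assert (HyB : Rabs y <= B).
  { unfold B; replace y with ((y - u) + u) by ring.
    eapply Rle_trans; [apply Rabs_triang | lra]. }
  replace (_ - _) with ((RInt (fun s => g s w) 0 y - RInt (fun s => g s v) 0 y)
     + (RInt (fun s => g s v) 0 y - RInt (fun s => g s v) 0 u)) by ring.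
  eapply Rle_lt_trans; [apply Rabs_triang|].
  replace (pos eps) with (eps / 2 + eps / 2) by lra.
  apply Rplus_le_lt_compat.
  - assert (Hi := is_RInt_minus _ _ _ _ _ _ (RInt_correct _ _ _ (Hex w 0 y))
      (RInt_correct _ _ _ (Hex v 0 y))).
    eapply Rle_trans; [apply (norm_RInt_le_const_abs _ 0 y _ (eps / 2 / B)) with (2 := Hi) |].
    + intros s Hs. apply Rlt_le.
      assert (Hs' : Rabs s <= B).
      { apply Rle_trans with (2 := HyB). revert Hs; unfold Rmin, Rmax, Rabs.
        repeat destruct Rle_dec; repeat destruct Rcase_abs; lra. }
      apply Rabs_le_between in Hs'.
      apply (Hd1 s v s w); try lra.
      * apply Rabs_le_between'; lra.
      * rewrite Rminus_diag, Rabs_R0; apply cond_pos.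
    + rewrite Rminus_0_r.
      apply Rle_trans with (B * (eps / 2 / B)).
      * apply Rmult_le_compat_r; lra.
      * right; field; lra.
  - apply Hd2. change (Rabs (y - u) < d2); lra.
Qed.

(** Differentiation under the integral sign: this derivative in the inner bound is what gives
    solutions of the Goursat problem a derivative in u. *)
Lemma is_derive_RInt_iterated (g : R -> R -> R) (u v : R) :
  (forall u v, continuity_2d_pt g u v) ->
  is_derive (fun u => RInt (fun w => RInt (fun s => g s w) 0 u) 0 v) u
    (RInt (fun w => g u w) 0 v).
Proof.
  intros Hg.
  assert (HD : forall x t, is_derive (fun y => RInt (fun s => g s t) 0 y) x (g x t)).
  { intros x t; apply (is_derive_RInt_right (fun s => g s t)).
    intros; apply continuity_2d_pt_slice1, Hg. }
  evar_last.
  - apply (is_derive_RInt_param (fun y w => RInt (fun s => g s w) 0 y)).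
    + apply filter_forall; intros x t _; eexists; apply HD.
    + intros t _. apply (continuity_2d_pt_ext g); [|apply Hg].
      intros x y; symmetry; apply is_derive_unique, HD.
    + apply filter_forall; intros y; apply (ex_RInt_continuous (V := R_CompleteNormedModule)).
      intros z _; apply (continuity_2d_pt_slice2 (fun u v => RInt (fun s => g s v) 0 u)),
        RInt_slice_continuity_2d, Hg.
  - apply RInt_ext; intros x _; apply is_derive_unique, HD.
Qed.

Definition Ccontinuous2 (F : R -> R -> C) : Prop :=
  forall u v, continuity_2d_pt (fun s w => Re (F s w)) u v /\
              continuity_2d_pt (fun s w => Im (F s w)) u v.

Lemma Ccontinuous2_of_continuous (F : R -> R -> C) :
  (forall u v, @continuous (prod_UniformSpace R_UniformSpace R_UniformSpace) C_R_NormedModule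
     (fun p => F (fst p) (snd p)) (u, v)) -> Ccontinuous2 F.
Proof.
  intros H u v; destruct (proj1 (Ccontinuous_parts _ _ _) (H u v)) as [H1 H2].
  split; apply continuity_2d_pt_filterlim; assumption.
Qed.

Lemma Ccontinuous2_plus (F G : R -> R -> C) :
  Ccontinuous2 F -> Ccontinuous2 G -> Ccontinuous2 (fun u v => F u v + G u v)%C.
Proof.
  intros HF HG u v; split; apply continuity_2d_pt_plus; first [apply HF | apply HG].
Qed.

Lemma Ccontinuous2_fst (h : R -> C) :
  (forall x, Ccontinuous h x) -> Ccontinuous2 (fun u _ => h u).
Proof.
  intros Hh u v.
  destruct (proj1 (Ccontinuous_parts R_UniformSpace _ _) (Hh u)) as [C1 C2].
  apply continuity_pt_filterlim in C1, C2.
  split.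
  - apply (continuity_1d_2d_pt_comp (fun s => Re (h s)) (fun u _ => u)); trivial.
    apply continuity_2d_pt_id1.
  - apply (continuity_1d_2d_pt_comp (fun s => Im (h s)) (fun u _ => u)); trivial.
    apply continuity_2d_pt_id1.
Qed.

Lemma Ccontinuous2_along (F : R -> R -> C) (al be : R -> R) (x : R) :
  Ccontinuous2 F -> continuous al x -> continuous be x ->
  Ccontinuous (fun s => F (al s) (be s)) x.
Proof.
  intros HF H1 H2; destruct (HF (al x) (be x)) as [C1 C2].
  apply continuity_2d_pt_filterlim in C1, C2.
  apply Ccontinuous_parts; split.
  - exact (continuous_comp_2 _ _ (fun a b : R => Re (F a b)) x H1 H2 C1).
  - exact (continuous_comp_2 _ _ (fun a b : R => Im (F a b)) x H1 H2 C2).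
Qed.

(** Walk from the origin to (u,v) in a fixed number N of steps, each shorter than a modulus of
    uniform continuity for 1: every step changes F by less than 1. *)
Lemma bounded_on_square (F : R -> R -> R) (b : R) :
  (forall u v, continuity_2d_pt F u v) ->
  exists M, forall u v, Rabs u <= b -> Rabs v <= b -> Rabs (F u v) <= M.
Proof.
  intros HF.
  destruct (uniform_continuity_2d F (-b) b (-b) b ltac:(intros; apply HF) (mkposreal 1 Rlt_0_1))
    as [d Hd]; simpl in Hd.
  assert (Hd0 := cond_pos d).
  destruct (INR_unbounded (Rabs b / d)) as [n Hn].
  (* N steps suffice to make b / N smaller than the modulus d. *)
  set (N := INR n + 1).
  assert (HN : 0 < N) by (unfold N; assert (H := pos_INR n); lra).
  assert (HbN : Rabs b / N < d).
  { apply Rmult_lt_reg_r with N; trivial.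
    replace (Rabs b / N * N) with (Rabs b / d * d) by (field; lra).
    rewrite (Rmult_comm d); apply Rmult_lt_compat_r; unfold N; lra. }
  exists (Rabs (F 0 0) + N); intros u v Hu Hv.
  assert (Hbb : Rabs b = b) by (apply Rabs_pos_eq; assert (H := Rabs_pos u); lra).
  rewrite Hbb in *.
  apply Rabs_le_between in Hu, Hv.
  assert (Hk : forall k, (k <= S n)%nat ->
    Rabs (F (INR k / N * u) (INR k / N * v)) <= Rabs (F 0 0) + INR k).
  { induction k as [|k IH]; intros Hkn.
    - simpl; replace (0 / N) with 0 by (field; lra); rewrite !Rmult_0_l; lra.
    - assert (Hin : forall j, (j <= S n)%nat -> 0 <= INR j / N <= 1).
      { intros j Hj; apply le_INR in Hj; rewrite (S_INR n) in Hj; fold N in Hj.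
        assert (H := pos_INR j); split.
        - apply Rdiv_le_0_compat; lra.
        - apply Rmult_le_reg_r with N; trivial. unfold Rdiv; rewrite Rmult_assoc, Rinv_l; lra. }
      assert (I1 := Hin k ltac:(auto with arith)); assert (I2 := Hin (S k) Hkn).
      assert (Hstep : forall z, -b <= z <= b -> Rabs (INR (S k) / N * z - INR k / N * z) < d).
      { intros z Hz; replace (_ - _) with (z / N) by (rewrite S_INR; field; lra).
        apply Rle_lt_trans with (2 := HbN). unfold Rdiv; rewrite Rabs_mult, (Rabs_pos_eq (/ N)).
        - apply Rmult_le_compat_r; [apply Rlt_le, Rinv_0_lt_compat; trivial | apply Rabs_le; lra].
        - apply Rlt_le, Rinv_0_lt_compat; trivial. }
      assert (Hs := Hd (INR k / N * u) (INR k / N * v) (INR (S k) / N * u) (INR (S k) / N * v)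
        ltac:(nra) ltac:(nra) ltac:(nra) ltac:(nra) (Hstep u Hu) (Hstep v Hv)).
      rewrite (S_INR k) at 3.
      replace (F (INR (S k) / N * u) (INR (S k) / N * v)) with
        ((F (INR (S k) / N * u) (INR (S k) / N * v) - F (INR k / N * u) (INR k / N * v))
          + F (INR k / N * u) (INR k / N * v)) by ring.
      eapply Rle_trans; [apply Rabs_triang|].
      specialize (IH ltac:(auto with arith)); lra. }
  specialize (Hk (S n) (le_n _)).
  assert (HSN : INR (S n) = N) by (unfold N; apply S_INR).
  rewrite HSN in Hk; replace (N / N) with 1 in Hk by (field; lra); rewrite !Rmult_1_l in Hk;
    exact Hk.
Qed.

Lemma Cmod_le_parts (z : C) : Cmod z <= Rabs (Re z) + Rabs (Im z).
Proof.
  unfold Cmod, Re, Im; rewrite <- (sqrt_square (Rabs (fst z) + Rabs (snd z))).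
  - apply sqrt_le_1_alt.
    rewrite <- (pow2_abs (fst z)), <- (pow2_abs (snd z)).
    assert (0 <= Rabs (fst z) * Rabs (snd z)) by (apply Rmult_le_pos; apply Rabs_pos). nra.
  - assert (H1 := Rabs_pos (fst z)); assert (H2 := Rabs_pos (snd z)); lra.
Qed.

Lemma Ccontinuous2_bounded (F : R -> R -> C) (b : R) : Ccontinuous2 F ->
  exists M, 0 <= M /\ forall u v, Rabs u <= b -> Rabs v <= b -> Cmod (F u v) <= M.
Proof.
  intros HF.
  destruct (bounded_on_square (fun u v => Re (F u v)) b ltac:(intros; apply HF)) as [M1 H1].
  destruct (bounded_on_square (fun u v => Im (F u v)) b ltac:(intros; apply HF)) as [M2 H2].
  exists (Rabs M1 + Rabs M2); split.
  - assert (A := Rabs_pos M1); assert (B := Rabs_pos M2); lra.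
  - intros u v Hu Hv; eapply Rle_trans; [apply Cmod_le_parts|].
    apply Rplus_le_compat; (eapply Rle_trans; [|apply Rle_abs]); auto.
Qed.

(** The regularity of a Goursat solution with continuous right-hand side g: class C^1, with the
    mixed derivative g in both orders; pure second derivatives need not exist. *)
Record mixed_primitive (E Eu Ev g : R -> R -> C) : Prop := {
  mp_u : forall u v, is_Cderive (fun s => E s v) u (Eu u v);
  mp_v : forall u v, is_Cderive (fun s => E u s) v (Ev u v);
  mp_uv : forall u v, is_Cderive (fun s => Eu u s) v (g u v);
  mp_vu : forall u v, is_Cderive (fun s => Ev s v) u (g u v);
  mp_cont : Ccontinuous2 E;
  mp_cont_u : Ccontinuous2 Eu;
  mp_cont_v : Ccontinuous2 Ev }.

(** The primitive is c(u) plus the integral of g over the rectangle spanned by 0 and (u,v). *)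
Lemma mixed_primitive_exists (c c' : R -> C) (g : R -> R -> C) :
  (forall x, is_Cderive c x (c' x)) -> (forall x, Ccontinuous c' x) -> Ccontinuous2 g ->
  exists E Eu Ev, mixed_primitive E Eu Ev g /\
    (forall u, E u 0 = c u) /\ (forall v, E 0 v = c 0) /\
    (forall u, Eu u 0 = c' u) /\ (forall v, Ev 0 v = RtoC 0).
Proof.
  intros Hc Hc' Hg.
  set (g1 := fun s w => Re (g s w)); set (g2 := fun s w => Im (g s w)).
  assert (Hg1 : forall u v, continuity_2d_pt g1 u v) by (intros; apply Hg).
  assert (Hg2 : forall u v, continuity_2d_pt g2 u v) by (intros; apply Hg).
  assert (Hs : forall k : R -> R -> R, (forall u v, continuity_2d_pt k u v) ->
    forall u v, continuity_2d_pt (fun s w => k w s) u v).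
  { intros; now apply continuity_2d_pt_swap. }
  set (J := fun (k : R -> R -> R) u v => RInt (fun s => k s v) 0 u).
  set (J' := fun (k : R -> R -> R) u v => RInt (fun w => k u w) 0 v).
  set (I := fun (k : R -> R -> R) u v => RInt (fun w => J k u w) 0 v).
  assert (HJ : forall k, (forall u v, continuity_2d_pt k u v) ->
     forall u v, continuity_2d_pt (J k) u v).
  { intros k Hk u v; now apply RInt_slice_continuity_2d. }
  assert (HJ' : forall k, (forall u v, continuity_2d_pt k u v) ->
     forall u v, continuity_2d_pt (J' k) u v).
  { intros k Hk u v; apply (continuity_2d_pt_swap (fun v u => J' k u v)).
    apply (RInt_slice_continuity_2d (fun w s => k s w)); auto. }
  assert (DJ : forall k, (forall u v, continuity_2d_pt k u v) ->
     forall u v, is_derive (fun s => J k s v) u (k u v)).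
  { intros k Hk u v; apply (is_derive_RInt_right (fun s => k s v)).
    intros; now apply continuity_2d_pt_slice1. }
  assert (DJ' : forall k, (forall u v, continuity_2d_pt k u v) ->
     forall u v, is_derive (fun s => J' k u s) v (k u v)).
  { intros k Hk u v; apply (is_derive_RInt_right (fun s => k u s)).
    intros; now apply continuity_2d_pt_slice2. }
  assert (DIu : forall k, (forall u v, continuity_2d_pt k u v) ->
     forall u v, is_derive (fun s => I k s v) u (J' k u v)).
  { intros k Hk u v; now apply is_derive_RInt_iterated. }
  assert (DIv : forall k, (forall u v, continuity_2d_pt k u v) ->
     forall u v, is_derive (fun s => I k u s) v (J k u v)).
  { intros k Hk u v; apply (is_derive_RInt_right (fun s => J k u s)).
    intros; apply continuity_2d_pt_slice2; auto. }
  exists (fun u v => c u + (I g1 u v, I g2 u v))%C,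
         (fun u v => c' u + (J' g1 u v, J' g2 u v))%C,
         (fun u v => (J g1 u v, J g2 u v)).
  assert (Z : forall h : R -> R, RInt h 0 0 = 0)
    by (intros; apply (RInt_point (V := R_CompleteNormedModule))).
  assert (Z' : forall h : R -> R, (forall x, h x = 0) -> forall v, RInt h 0 v = 0).
  { intros h Hh v; rewrite (RInt_ext h (fun _ => 0)) by (intros; apply Hh).
    rewrite (RInt_const (V := R_CompleteNormedModule)). apply Rmult_0_r. }
  split; [constructor|].
  - intros u v; apply is_Cderive_plus; [apply Hc|].
    apply is_Cderive_pair; auto.
  - intros u v; apply is_Cderive_eq with (RtoC 0 + (J g1 u v, J g2 u v))%C; [|ring].
    apply is_Cderive_plus; [apply is_Cderive_const|].
    apply is_Cderive_pair; auto.
  - intros u v; apply is_Cderive_eq with (RtoC 0 + (g1 u v, g2 u v))%C.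
    + apply is_Cderive_plus; [apply is_Cderive_const|].
      apply is_Cderive_pair; auto.
    + rewrite Cplus_0_l; symmetry; apply surjective_pairing.
  - intros u v; apply is_Cderive_eq with ((g1 u v, g2 u v))%C.
    + apply is_Cderive_pair; auto.
    + symmetry; apply surjective_pairing.
  - apply Ccontinuous2_plus.
    + apply Ccontinuous2_fst; intros x.
      apply (ex_derive_continuous (V := C_R_NormedModule)); eexists; apply Hc.
    + intros u v; split; apply HJ', HJ; assumption.
  - apply Ccontinuous2_plus; [now apply Ccontinuous2_fst|].
    intros u v; split; apply HJ'; assumption.
  - intros u v; split; apply HJ; assumption.
  - unfold I, J, J'; split; [|split; [|split]].
    + intros u; rewrite !Z; apply Cplus_0_r.
    + intros v; rewrite !Z' by (intros; apply Z); apply Cplus_0_r.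
    + intros u; rewrite !Z; apply Cplus_0_r.
    + intros v; rewrite !Z; reflexivity.
Qed.

(** The chain rule along a planar curve: a continuous first partial derivative together with the
    other partial derivative gives total differentiability. *)
Lemma is_derive_along (E Eu Ev : R -> R -> R) (al be : R -> R) (x da db : R) :
  (forall u v, is_derive (fun s => E s v) u (Eu u v)) ->
  is_derive (fun s => E (al x) s) (be x) (Ev (al x) (be x)) ->
  continuity_2d_pt Eu (al x) (be x) ->
  is_derive al x da -> is_derive be x db ->
  is_derive (fun s => E (al s) (be s)) x (da * Eu (al x) (be x) + db * Ev (al x) (be x)).
Proof.
  intros Hu Hv Hc Ha Hb.
  apply continuity_2d_pt_filterlim in Hc.
  assert (Hd := is_derive_filterdiff E (al x) (be x) Eu (Ev (al x) (be x))
    ltac:(apply filter_forall; intros p; apply Hu) Hv Hc).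
  assert (H := filterdiff_comp'_2 (K := R_AbsRing) _ _ (fun a b : R => E a b) x _ _
    (fun p q : R => plus (scal p (Eu (al x) (be x))) (scal q (Ev (al x) (be x)))) Ha Hb Hd).
  apply (filterdiff_ext_lin _ _ _ H).
  intros y; unfold plus, scal; simpl; unfold mult; simpl; ring.
Qed.

Lemma mixed_primitive_along (E Eu Ev g : R -> R -> C) (al be : R -> R) (x da db : R) :
  mixed_primitive E Eu Ev g -> is_derive al x da -> is_derive be x db ->
  is_Cderive (fun s => E (al s) (be s)) x
    (RtoC da * Eu (al x) (be x) + RtoC db * Ev (al x) (be x))%C.
Proof.
  intros [HEu HEv _ _ _ HCu _] Ha Hb; apply is_Cderive_parts; split.
  - evar_last.
    + apply (is_derive_along (fun u v => Re (E u v)) (fun u v => Re (Eu u v))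
               (fun u v => Re (Ev u v)) al be x da db); trivial.
      * intros u v; exact (proj1 (proj1 (is_Cderive_parts _ _ _) (HEu u v))).
      * exact (proj1 (proj1 (is_Cderive_parts _ _ _) (HEv (al x) (be x)))).
      * apply HCu.
    + unfold Re; simpl; ring.
  - evar_last.
    + apply (is_derive_along (fun u v => Im (E u v)) (fun u v => Im (Eu u v))
               (fun u v => Im (Ev u v)) al be x da db); trivial.
      * intros u v; exact (proj2 (proj1 (is_Cderive_parts _ _ _) (HEu u v))).
      * exact (proj2 (proj1 (is_Cderive_parts _ _ _) (HEv (al x) (be x)))).
      * apply HCu.
    + unfold Im; simpl; ring.
Qed.

(** * Regularity of solutions of the Goursat problem *)

(** The amount by which the sum of the two clamped coordinates leaves [-b,b]. *)
Definition hex_excess (b u v : R) : R :=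
  clamp (-b) b u + clamp (-b) b v - clamp (-b) b (clamp (-b) b u + clamp (-b) b v).

(** Splitting the excess of u + v evenly between the two coordinates keeps each of them in [-b,b]
    and brings the sum back into [-b,b]. *)
Definition hex_retract (b : R) (p : R * R) : R * R :=
  let k := hex_excess b (fst p) (snd p) in
  (clamp (-b) b (fst p) - k / 2, clamp (-b) b (snd p) - k / 2).

Lemma hex_retract_in (b : R) (p : R * R) : 0 < b ->
  goursat_dom b (fst (hex_retract b p)) (snd (hex_retract b p)).
Proof.
  intros Hb; unfold hex_retract, hex_excess; simpl.
  assert (H1 := clamp_in (-b) b (fst p) ltac:(lra)).
  assert (H2 := clamp_in (-b) b (snd p) ltac:(lra)).
  set (u := clamp (-b) b (fst p)) in *; set (v := clamp (-b) b (snd p)) in *; clearbody u v.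
  unfold goursat_dom, clamp, Rmax, Rmin; repeat split; apply Rabs_le; repeat destruct Rle_dec;
    lra.
Qed.

Lemma hex_retract_id (b u v : R) : goursat_dom b u v -> hex_retract b (u, v) = (u, v).
Proof.
  intros (H1 & H2 & H3); apply Rabs_le_between in H1, H2, H3.
  unfold hex_retract, hex_excess; simpl; rewrite !(clamp_id _ _ _ H1), !(clamp_id _ _ _ H2),
    !(clamp_id _ _ _ H3); f_equal; lra.
Qed.

Lemma hex_retract_continuous (b : R) (p : R * R) :
  @continuous R2 R2 (hex_retract b) p.
Proof.
  assert (Hf : @continuous R2 R_UniformSpace fst p)
    by (destruct p; apply (continuous_fst (U := R_UniformSpace))).
  assert (Hs : @continuous R2 R_UniformSpace snd p)
    by (destruct p; apply (continuous_snd (U := R_UniformSpace))).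
  assert (Hcl : forall h : R * R -> R, @continuous R2 R_UniformSpace h p ->
     @continuous R2 R_UniformSpace (fun p => clamp (-b) b (h p)) p).
  { intros h Hh; apply (continuous_comp (V := R_UniformSpace) h (clamp (-b) b)); trivial;
      apply continuous_clamp. }
  assert (Hk : @continuous R2 R_UniformSpace (fun p => hex_excess b (fst p) (snd p)) p).
  { apply (continuous_minus (U := R2) (V := R_NormedModule)); [|apply Hcl];
      apply (continuous_plus (U := R2) (V := R_NormedModule)); apply Hcl; assumption. }
  assert (Hk2 : @continuous R2 R_UniformSpace (fun p => hex_excess b (fst p) (snd p) / 2) p).
  { apply (continuous_mult (U := R2) (K := R_AbsRing)); trivial; apply continuous_const. }
  apply (Ccontinuous_parts R2 (hex_retract b) p); split.
  - apply (continuous_minus (U := R2) (V := R_NormedModule) (fun p => clamp (-b) b (fst p)));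
      auto.
  - apply (continuous_minus (U := R2) (V := R_NormedModule) (fun p => clamp (-b) b (snd p)));
      auto.
Qed.

Lemma convex_goursat1 (b v : R) : convex_set (fun s => goursat_dom b s v).
Proof.
  intros x y z (H1 & H2 & H3) (H4 & H5 & H6) Hz.
  apply Rabs_le_between in H1, H2, H3, H4, H5, H6.
  repeat split; apply Rabs_le; lra.
Qed.

Lemma convex_goursat2 (b u : R) : convex_set (fun s => goursat_dom b u s).
Proof.
  intros x y z (H1 & H2 & H3) (H4 & H5 & H6) Hz.
  apply Rabs_le_between in H1, H2, H3, H4, H5, H6.
  repeat split; apply Rabs_le; lra.
Qed.

(** Relative derivatives along a slice are determined because no vertical slice of the hexagon is a
    single point. *)
Lemma goursat_slice2_nontrivial (b u v : R) : 0 < b -> goursat_dom b u v ->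
  exists z, goursat_dom b u z /\ z <> v.
Proof.
  intros Hb (H1 & H2 & H3); apply Rabs_le_between in H1, H2, H3.
  destruct (Req_dec v 0) as [->|Hv].
  - destruct (Rle_dec 0 u).
    + exists (-b); split; [|lra]; repeat split; apply Rabs_le; lra.
    + exists b; split; [|lra]; repeat split; apply Rabs_le; lra.
  - exists 0; split; [|auto]; repeat split; apply Rabs_le; lra.
Qed.

Lemma goursat_dom_axes (b u v : R) : goursat_dom b u v ->
  goursat_dom b u 0 /\ goursat_dom b 0 v /\ sym_itv b u /\ sym_itv b v /\ sym_itv b (u + v).
Proof.
  intros (H1 & H2 & H3); apply Rabs_le_between in H1, H2, H3.
  repeat split; try apply Rabs_le; lra.
Qed.

(** Integrating H_vu = q H in u and then in v, with H_v = 0 on the v-axis, identifies H on the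
    hexagon with the mixed primitive of an extension of q H to the plane. *)
Lemma goursat_regular (b : R) (q : R -> C) (h : C) (H : R -> R -> C) :
  0 < b -> @continuous_on R_UniformSpace C_R_NormedModule (sym_itv b) q ->
  goursat_solution b q h H ->
  exists E Eu Ev g, mixed_primitive E Eu Ev g /\
    (forall u v, goursat_dom b u v -> H u v = E u v) /\
    (forall u v, goursat_dom b u v -> g u v = q (u + v)%R * E u v)%C /\
    (forall u, sym_itv b u -> Eu u 0 = / 2 * q u)%C /\
    (forall v, Ev 0 v = RtoC 0) /\
    (forall v, E 0 v = h / 2)%C.
Proof.
  intros Hb Hq [Hcont Hexv Heq Hu Hv].
  set (qt := fun s => q (clamp (-b) b s)).
  assert (Hqt : forall s, Ccontinuous qt s).
  { intros s; apply (continuous_on_retract R_UniformSpace R_UniformSpace C_R_NormedModule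
      (sym_itv b) q (clamp (-b) b)); trivial.
    - intros y; exact (clamp_in (-b) b y ltac:(lra)).
    - apply continuous_clamp. }
  set (r1 := fun u v => fst (hex_retract b (u, v))).
  set (r2 := fun u v => snd (hex_retract b (u, v))).
  set (g := fun u v => (qt (r1 u v + r2 u v)%R * H (r1 u v) (r2 u v))%C).
  assert (Hg : Ccontinuous2 g).
  { apply Ccontinuous2_of_continuous; intros u v.
    assert (Hret := hex_retract_continuous b (u, v)).
    destruct (proj1 (Ccontinuous_parts R2 (hex_retract b) _) Hret) as [C1 C2].
    apply (continuous_ext (T := R2) (fun p => qt (fst (hex_retract b p) + snd (hex_retract b p))%R
            * H (fst (hex_retract b p)) (snd (hex_retract b p)))%C).
    { intros [s w]; reflexivity. }
    apply (Ccontinuous_mult R2).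
    - apply (continuous_comp (U := R2) (V := R_UniformSpace) (W := C_R_NormedModule)
        (fun p => fst (hex_retract b p) + snd (hex_retract b p)) qt); [|apply Hqt].
      apply (continuous_plus (U := R2) (V := R_NormedModule)); assumption.
    - apply (continuous_on_retract R2 R2 C_R_NormedModule _ _ (hex_retract b) _ Hcont); trivial.
      intros y; now apply hex_retract_in. }
  assert (Hgd : forall u v, goursat_dom b u v -> g u v = (q (u + v)%R * H u v)%C).
  { intros u v Hd; unfold g, r1, r2, qt; rewrite hex_retract_id by trivial; simpl.
    rewrite clamp_id; trivial. now apply goursat_dom_axes. }
  destruct (mixed_primitive_exists (fun u => h / 2 + / 2 * CInt qt 0 u)%C (fun u => / 2 * qt
    u)%C g)
    as (E & Eu & Ev & HE & E1 & E2 & E3 & E4); trivial.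
  { intros x; apply is_Cderive_eq with (0 + (0 * CInt qt 0 x + / 2 * qt x))%C; [|ring].
    apply is_Cderive_plus; [apply is_Cderive_const|].
    apply (is_Cderive_mult (fun _ => / 2)%C (fun u => CInt qt 0 u));
      [apply is_Cderive_const | now apply is_Cderive_CInt]. }
  { intros x; apply (Ccontinuous_mult R_UniformSpace); trivial; apply continuous_const. }
  exists E, Eu, Ev, g.
  (* First integration, in u: both sides have the same u-derivative and vanish for u = 0. *)
  assert (HP : forall u v, goursat_dom b u v -> partial2 (goursat_dom b) H u v = Ev u v).
  { intros u v Hd; destruct (goursat_dom_axes _ _ _ Hd) as (_ & Hd0 & _ & Hv' & _).
    assert (Z : (partial2 (goursat_dom b) H u v - Ev u v
              = partial2 (goursat_dom b) H 0 v - Ev 0 v)%C).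
    { apply (constant_of_zero_derive_on (fun s => goursat_dom b s v)
        (fun s => partial2 (goursat_dom b) H s v - Ev s v)%C); trivial.
      - apply convex_goursat1.
      - intros s Hs. replace (RtoC 0) with (q (s + v)%R * H s v - g s v)%C by (rewrite Hgd;
          trivial; ring).
        apply is_derive_on_minus; [now apply Heq|].
        apply (is_derive_on_of_is_derive _ _ (fun s => Ev s v)); trivial. apply HE. }
    assert (Z' : partial2 (goursat_dom b) H 0 v = RtoC 0).
    { destruct (goursat_slice2_nontrivial b 0 v Hb Hd0) as [z [Hz1 Hz2]].
      apply (Derive_on_unique _ _ v z); trivial; [apply convex_goursat2|].
      apply (is_derive_on_of_is_derive _ _ (fun _ => h / 2)%C); trivial;
        [|apply is_Cderive_const].
      intros y Hy; apply Hv. now apply goursat_dom_axes in Hy. }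
    rewrite Z', E4 in Z.
    replace (partial2 (goursat_dom b) H u v)
      with (partial2 (goursat_dom b) H u v - Ev u v + Ev u v)%C by ring. rewrite Z; ring. }
  (* Second integration, in v: both sides have the same v-derivative and agree for v = 0. *)
  assert (HHE : forall u v, goursat_dom b u v -> H u v = E u v).
  { intros u v Hd; destruct (goursat_dom_axes _ _ _ Hd) as (Hd0 & _ & Hu' & _ & _).
    assert (Z : (H u v - E u v = H u 0 - E u 0)%C).
    { apply (constant_of_zero_derive_on (fun s => goursat_dom b u s)
        (fun s => H u s - E u s)%C); trivial.
      - apply convex_goursat2.
      - intros s Hs. replace (RtoC 0) with (Ev u s - Ev u s)%C by ring.
        apply is_derive_on_minus.
        + destruct (Hexv u s Hs) as [l Hl].
          destruct (goursat_slice2_nontrivial b u s Hb Hs) as [z [Hz1 Hz2]].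
          rewrite <- HP by trivial. unfold partial2.
          rewrite (Derive_on_unique _ _ s z l (convex_goursat2 b u) Hs Hz1 Hz2 Hl); exact Hl.
        + apply (is_derive_on_of_is_derive _ _ (fun s => E u s)); trivial. apply HE. }
    rewrite E1, Hu in Z by trivial.
    replace (CInt q 0 u) with (CInt qt 0 u) in Z.
    - replace (H u v) with (H u v - E u v + E u v)%C by ring. rewrite Z; ring.
    - apply CInt_ext; intros s Hs; unfold qt; rewrite clamp_id; trivial.
      destruct Hu'; revert Hs; unfold Rmin, Rmax; repeat destruct Rle_dec; lra. }
  split; [trivial|]. split; [trivial|]. split; [|split; [|split]]; trivial.
  - intros u v Hd; rewrite Hgd, HHE by trivial; reflexivity.
  - intros u Hu'; rewrite E3; unfold qt; rewrite clamp_id; trivial.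
  - intros v; rewrite E2, CInt_point; ring.
Qed.

(** * A uniqueness theorem for first-order Goursat systems *)

(** The hexagon is closed under moving one coordinate towards 0, so the integration paths used below
    stay inside it. *)
Lemma goursat_dom_segment1 (b u v s : R) :
  goursat_dom b u v -> Rmin 0 u <= s <= Rmax 0 u -> goursat_dom b s v.
Proof.
  intros (H1 & H2 & H3) Hs; apply Rabs_le_between in H1, H2, H3.
  revert Hs; unfold Rmin, Rmax; destruct Rle_dec; intros; repeat split; apply Rabs_le; lra.
Qed.

Lemma goursat_dom_segment2 (b u v s : R) :
  goursat_dom b u v -> Rmin 0 v <= s <= Rmax 0 v -> goursat_dom b u s.
Proof.
  intros (H1 & H2 & H3) Hs; apply Rabs_le_between in H1, H2, H3.
  revert Hs; unfold Rmin, Rmax; destruct Rle_dec; intros; repeat split; apply Rabs_le; lra.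
Qed.

Lemma exp_bound_right (F F' : R -> R) (B lam v : R) : 0 <= v -> 0 <= B ->
  (forall s, 0 <= s <= v -> is_derive F s (F' s)) ->
  (forall s, 0 <= s <= v -> F' s <= B * lam * exp (lam * s)) -> F 0 = 0 ->
  F v <= B * exp (lam * v).
Proof.
  intros Hv HB HF HF' F0.
  assert (D : forall s, 0 <= s <= v ->
     is_derive (fun s => B * exp (lam * s) - F s) s (B * lam * exp (lam * s) - F' s)).
  { intros s Hs; evar_last.
    - apply (is_derive_minus (V := R_NormedModule) (fun s => B * exp (lam * s)) F).
      + auto_derive; trivial.
      + now apply HF.
    - unfold minus, plus, opp; simpl; ring. }
  destruct (MVT_gen (fun s => B * exp (lam * s) - F s) 0 v
     (fun s => B * lam * exp (lam * s) - F' s)) as [c [Hc1 Hc2]].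
  - intros s; rewrite Rmin_left, Rmax_right by trivial; intros; apply D; lra.
  - intros s; rewrite Rmin_left, Rmax_right by trivial; intros; apply continuity_pt_filterlim.
    apply (ex_derive_continuous (V := R_NormedModule) (fun s => B * exp (lam * s) - F s) s).
    eexists; apply D; lra.
  - rewrite Rmin_left, Rmax_right in Hc1 by trivial.
    rewrite F0, Rmult_0_r, exp_0 in Hc2.
    specialize (HF' c Hc1).
    assert (0 <= (B * lam * exp (lam * c) - F' c) * (v - 0)) by (apply Rmult_le_pos; lra).
    lra.
Qed.

(** Exponential weights are reproduced by integration, with a gain of a factor lam: this is the
    estimate behind the contraction in [goursat_system_zero]. *)
Lemma exp_bound (F F' : R -> R) (B lam v : R) : 0 <= B ->
  (forall s, Rmin 0 v <= s <= Rmax 0 v -> is_derive F s (F' s)) ->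
  (forall s, Rmin 0 v <= s <= Rmax 0 v -> Rabs (F' s) <= B * lam * exp (lam * Rabs s)) ->
    F 0 = 0 ->
  Rabs (F v) <= B * exp (lam * Rabs v).
Proof.
  intros HB HF HF' F0.
  (* The signs e and d reduce the two-sided bound on a segment of either orientation to
     [exp_bound_right]. *)
  assert (Hgen : forall e d, (e = 1 \/ e = -1) -> (d = 1 \/ d = -1) -> 0 <= d * v ->
     e * F v <= B * exp (lam * Rabs v)).
  { intros e d He Hd Hdv.
    assert (Ev : d * (d * v) = v) by (destruct Hd; subst; ring).
    assert (Ea : Rabs v = d * v).
    { destruct Hd; subst; unfold Rabs; destruct Rcase_abs; lra. }
    assert (Hin : forall s, 0 <= s <= d * v -> Rmin 0 v <= d * s <= Rmax 0 v /\ Rabs (d * s) = s).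
    { intros s Hs; split; [|destruct Hd; subst; unfold Rabs; destruct Rcase_abs; lra].
      destruct Hd; subst; unfold Rmin, Rmax; repeat destruct Rle_dec; lra. }
    rewrite Ea; replace (F v) with (F (d * (d * v))) by (rewrite Ev; trivial).
    apply (exp_bound_right (fun s => e * F (d * s)) (fun s => e * (d * F' (d * s)))
      B lam (d * v)); trivial.
    - intros s Hs; apply is_derive_scal.
      apply (is_derive_comp (V := R_NormedModule) F (fun s => d * s)).
      + apply HF, Hin, Hs.
      + auto_derive; trivial; ring.
    - intros s Hs; destruct (Hin s Hs) as [H1 H2]; specialize (HF' _ H1); rewrite H2 in HF'.
      apply Rle_trans with (2 := HF').
      destruct He, Hd; subst; unfold Rabs; destruct Rcase_abs; lra.
    - rewrite Rmult_0_r, F0; ring. }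
  assert (Hd : exists d, (d = 1 \/ d = -1) /\ 0 <= d * v).
  { destruct (Rle_dec 0 v); [exists 1 | exists (-1)]; split; auto; lra. }
  destruct Hd as [d [Hd1 Hd2]].
  assert (H1 := Hgen 1 d ltac:(auto) Hd1 Hd2); assert (H2 := Hgen (-1) d ltac:(auto) Hd1 Hd2).
  apply Rabs_le; lra.
Qed.

Lemma Cexp_bound (F F' : R -> C) (B lam v : R) : 0 <= B ->
  (forall s, Rmin 0 v <= s <= Rmax 0 v -> is_Cderive F s (F' s)) ->
  (forall s, Rmin 0 v <= s <= Rmax 0 v -> Cmod (F' s) <= B * lam * exp (lam * Rabs s)) ->
  F 0 = RtoC 0 -> Cmod (F v) <= 2 * B * exp (lam * Rabs v).
Proof.
  intros HB HF HF' F0.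
  eapply Rle_trans; [apply Cmod_le_parts|].
  replace (2 * B * _) with (B * exp (lam * Rabs v) + B * exp (lam * Rabs v)) by ring.
  apply Rplus_le_compat.
  - apply (exp_bound (fun s => Re (F s)) (fun s => Re (F' s))); trivial.
    + intros s Hs; exact (proj1 (proj1 (is_Cderive_parts _ _ _) (HF s Hs))).
    + intros s Hs; eapply Rle_trans; [apply re_le_Cmod | auto].
    + now rewrite F0.
  - apply (exp_bound (fun s => Im (F s)) (fun s => Im (F' s))); trivial.
    + intros s Hs; exact (proj2 (proj1 (is_Cderive_parts _ _ _) (HF s Hs))).
    + intros s Hs; eapply Rle_trans; [|apply (HF' s Hs)].
      eapply Rle_trans; [apply Rmax_r | apply Rmax_Cmod].
    + now rewrite F0.
Qed.

Lemma Cmod_eq_0_of_geometric (z : C) (c : R) :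
  (forall n, Cmod z <= c * (/ 2) ^ n) -> z = RtoC 0.
Proof.
  intros H; apply Cmod_eq_0, Rle_antisym; [|apply Cmod_ge_0].
  assert (L : is_lim_seq (fun n => c * (/ 2) ^ n) (c * 0)).
  { apply (is_lim_seq_scal_l _ c 0), is_lim_seq_geom; rewrite Rabs_pos_eq; lra. }
  rewrite Rmult_0_r in L.
  exact (is_lim_seq_le (fun _ => Cmod z) _ (Cmod z) 0 H (is_lim_seq_const _) L).
Qed.

(** For lam >= 4A, integrating the system once halves any bound of the form
    m exp(lam |u|) exp(lam |v|) on P and Q; iterating, both are smaller than every positive number. *)
Lemma goursat_system_zero (b A M : R) (a : R -> C) (P Q : R -> R -> C) :
  0 <= A -> 0 <= M ->
  (forall x, sym_itv b x -> Cmod (a x) <= A) ->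
  (forall u v, goursat_dom b u v -> Cmod (P u v) <= M) ->
  (forall u v, goursat_dom b u v -> Cmod (Q u v) <= M) ->
  (forall u v, goursat_dom b u v -> is_Cderive (fun s => P u s) v (a (u + v)%R * Q u v)%C) ->
  (forall u v, goursat_dom b u v -> is_Cderive (fun s => Q s v) u (a (u + v)%R * P u v)%C) ->
  (forall u, sym_itv b u -> P u 0 = RtoC 0) ->
  (forall v, sym_itv b v -> Q 0 v = RtoC 0) ->
  forall u v, goursat_dom b u v -> P u v = RtoC 0 /\ Q u v = RtoC 0.
Proof.
  intros HA HM Ha HP HQ DP DQ P0 Q0.
  (* One factor 2 pays for bounding real and imaginary parts separately, another for the gain;
     the summand 1 keeps lam positive. *)
  set (lam := 4 * A + 1).
  assert (Hn : forall n u v, goursat_dom b u v ->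
     Cmod (P u v) <= M * (/ 2) ^ n * exp (lam * Rabs u) * exp (lam * Rabs v) /\
     Cmod (Q u v) <= M * (/ 2) ^ n * exp (lam * Rabs u) * exp (lam * Rabs v)).
  { induction n as [|n IH]; intros u v Hd.
    - assert (He : forall z, 1 <= exp (lam * Rabs z)).
      { intros z; apply Rle_trans with (1 + lam * Rabs z); [|apply exp_ineq1_le].
        assert (0 <= lam * Rabs z) by (apply Rmult_le_pos; [unfold lam; lra | apply Rabs_pos]).
        lra. }
      assert (E1 := He u); assert (E2 := He v).
      assert (E3 : 1 <= exp (lam * Rabs u) * exp (lam * Rabs v)) by nra.
      rewrite Rmult_1_r, Rmult_assoc.
      split; (apply Rle_trans with M; [auto | nra]).
    - set (m := M * (/ 2) ^ n) in *.
      assert (Hm : 0 <= m).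
      { apply Rmult_le_pos; trivial; apply pow_le; lra. }
      assert (Em : M * (/ 2) ^ S n = m / 2) by (unfold m; simpl; field).
      rewrite Em.
      assert (Hlam : A <= lam / 4) by (unfold lam; lra).
      split.
      + replace (m / 2 * exp (lam * Rabs u) * exp (lam * Rabs v))
          with (2 * (m * exp (lam * Rabs u) / 4) * exp (lam * Rabs v)) by field.
        assert (Hx := exp_pos (lam * Rabs u)).
        apply (Cexp_bound (fun s => P u s) (fun s => a (u + s)%R * Q u s)%C).
        * apply Rle_mult_inv_pos; [|lra]. apply Rmult_le_pos; lra.
        * intros s Hs; now apply DP, goursat_dom_segment2 with v.
        * intros s Hs. assert (Hds := goursat_dom_segment2 b u v s Hd Hs).
          rewrite Cmod_mult. destruct (IH u s Hds) as [_ IHs].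
          assert (Has := Ha (u + s) ltac:(now apply (goursat_dom_axes b u s))).
          replace (m * exp (lam * Rabs u) / 4 * lam * exp (lam * Rabs s))
            with ((lam / 4) * (m * exp (lam * Rabs u) * exp (lam * Rabs s))) by field.
          apply Rmult_le_compat; try apply Cmod_ge_0; lra.
        * apply P0; now apply (goursat_dom_axes b u v).
      + replace (m / 2 * exp (lam * Rabs u) * exp (lam * Rabs v))
          with (2 * (m * exp (lam * Rabs v) / 4) * exp (lam * Rabs u)) by field.
        assert (Hx := exp_pos (lam * Rabs v)).
        apply (Cexp_bound (fun s => Q s v) (fun s => a (s + v)%R * P s v)%C).
        * apply Rle_mult_inv_pos; [|lra]. apply Rmult_le_pos; lra.
        * intros s Hs; now apply DQ, goursat_dom_segment1 with u.
        * intros s Hs. assert (Hds := goursat_dom_segment1 b u v s Hd Hs).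
          rewrite Cmod_mult. destruct (IH s v Hds) as [IHs _].
          assert (Has := Ha (s + v) ltac:(now apply (goursat_dom_axes b s v))).
          replace (m * exp (lam * Rabs v) / 4 * lam * exp (lam * Rabs s))
            with ((lam / 4) * (m * exp (lam * Rabs s) * exp (lam * Rabs v))) by field.
          apply Rmult_le_compat; try apply Cmod_ge_0; lra.
        * apply Q0; now apply (goursat_dom_axes b u v). }
  intros u v Hd; split;
    apply (Cmod_eq_0_of_geometric _ (M * exp (lam * Rabs u) * exp (lam * Rabs v))); intros n;
    replace (M * exp (lam * Rabs u) * exp (lam * Rabs v) * (/ 2) ^ n)
      with (M * (/ 2) ^ n * exp (lam * Rabs u) * exp (lam * Rabs v)) by ring;
    now apply Hn.
Qed.

(** * The logarithmic derivative of f *)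

Lemma convex_sym_itv (b : R) : convex_set (sym_itv b).
Proof. intros x y z [H1 H2] [H3 H4] H5; split; lra. Qed.

Lemma Derive_on_sym_itv_correct (b : R) (g : R -> C) (x : R) :
  0 < b -> sym_itv b x -> ex_derive_on (sym_itv b) g x ->
  is_derive_on (sym_itv b) g x (Derive_on (sym_itv b) g x).
Proof.
  intros Hb Hx [l Hl].
  assert (Hz : exists z, sym_itv b z /\ z <> x).
  { destruct (Req_dec x 0); [exists b | exists 0]; split; unfold sym_itv; lra. }
  destruct Hz as [z [Hz1 Hz2]].
  rewrite (Derive_on_unique _ _ x z l (convex_sym_itv b) Hx Hz1 Hz2 Hl); exact Hl.
Qed.

(** The primitive of the clamped derivative has the same relative derivative as phi, hence agrees
    with it on [-b,b] once the values at 0 agree. *)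
Lemma C1_extension (b : R) (phi phi' : R -> C) : 0 < b ->
  (forall x, sym_itv b x -> is_derive_on (sym_itv b) phi x (phi' x)) ->
  @continuous_on R_UniformSpace C_R_NormedModule (sym_itv b) phi' ->
  exists psi psi' : R -> C, (forall x, is_Cderive psi x (psi' x)) /\
    (forall x, Ccontinuous psi' x) /\
    (forall x, sym_itv b x -> psi x = phi x /\ psi' x = phi' x).
Proof.
  intros Hb Hphi Hphi'.
  set (p := fun s => phi' (clamp (-b) b s)).
  assert (Hp : forall s, Ccontinuous p s).
  { intros s; apply (continuous_on_retract R_UniformSpace R_UniformSpace C_R_NormedModule
      (sym_itv b) phi' (clamp (-b) b)); trivial.
    - intros y; exact (clamp_in (-b) b y ltac:(lra)).
    - apply continuous_clamp. }
  assert (D : forall x, is_Cderive (fun x => phi 0%R + CInt p 0 x)%C x (p x)).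
  { intros x; apply is_Cderive_eq with (0 + p x)%C; [|ring].
    apply is_Cderive_plus; [apply is_Cderive_const | now apply is_Cderive_CInt]. }
  assert (Hpp : forall x, sym_itv b x -> p x = phi' x).
  { intros x Hx; unfold p; rewrite clamp_id; trivial. }
  exists (fun x => phi 0%R + CInt p 0 x)%C, p; split; [|split]; trivial.
  intros x Hx; split; auto.
  assert (Z : (phi x - (phi 0%R + CInt p 0 x) = phi 0%R - (phi 0%R + CInt p 0 0))%C).
  { apply (constant_of_zero_derive_on (sym_itv b) (fun x => phi x - (phi 0%R + CInt p 0 x))%C);
      trivial.
    - apply convex_sym_itv.
    - intros s Hs; replace (RtoC 0) with (phi' s - p s)%C by (rewrite Hpp; trivial; ring).
      apply is_derive_on_minus; [now apply Hphi|].
      apply (is_derive_on_of_is_derive _ _ (fun x => phi 0%R + CInt p 0 x)%C); trivial.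
    - unfold sym_itv; lra. }
  rewrite CInt_point in Z.
  replace (phi x) with (phi x - (phi 0%R + CInt p 0 x) + (phi 0%R + CInt p 0 x))%C by ring.
  rewrite Z; ring.
Qed.

Lemma continuous_on_of_eq (D : R -> Prop) (g h : R -> C) :
  (forall x, D x -> h x = g x) -> (forall x, D x -> Ccontinuous h x) ->
  @continuous_on R_UniformSpace C_R_NormedModule D g.
Proof.
  intros He Hh; apply (continuous_on_ext _ h); trivial. now apply continuous_on_forall.
Qed.

(** Here a extends f'/f, and F and G extend f and 1/f.  The two potentials are the Riccati
    expressions q_f = a' + a^2 and q_(1/f) = a^2 - a', and F and G solve y' = a y and y' = - a y on
    [-b,b]. *)
Lemma log_derivative_extension (b : R) (f : R -> C) : 0 < b ->
  C2_on (sym_itv b) f -> (forall x, sym_itv b x -> f x <> RtoC 0) ->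
  exists a a' F G : R -> C,
    (forall x, is_Cderive a x (a' x)) /\ (forall x, Ccontinuous a' x) /\
    (forall x, sym_itv b x -> a x = Derive_on (sym_itv b) f x / f x)%C /\
    (forall x, sym_itv b x -> q_f b f x = a' x + a x * a x)%C /\
    (forall x, sym_itv b x -> q_inv_f b f x = a x * a x - a' x)%C /\
    (forall x, sym_itv b x -> F x = f x /\ G x = / f x)%C /\
    (forall x, Ccontinuous F x /\ Ccontinuous G x) /\
    (forall x, sym_itv b x -> is_Cderive F x (a x * F x)%C /\ is_Cderive G x (- a x * G x)%C).
Proof.
  intros Hb (Hf1 & Hf2 & Hf3) Hf0.
  set (D := sym_itv b) in *.
  set (f' := Derive_on D f) in *; set (f'' := Derive_on D f') in *.
  assert (H1 : forall x, D x -> is_derive_on D f x (f' x)).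
  { intros x Hx; apply Derive_on_sym_itv_correct; auto. }
  assert (H2 : forall x, D x -> is_derive_on D f' x (f'' x)).
  { intros x Hx; apply Derive_on_sym_itv_correct; auto. }
  destruct (C1_extension b f f' Hb H1) as (F0 & F0' & A1 & A2 & A3).
  { now apply is_derive_on_continuous_on. }
  destruct (C1_extension b f' f'' Hb H2 Hf3) as (F1 & F1' & B1 & B2 & B3).
  assert (Hn : forall x, D x -> F0 x <> RtoC 0).
  { intros x Hx; rewrite (proj1 (A3 x Hx)); auto. }
  assert (DI : forall x, D x -> is_Cderive (fun s => / F0 s)%C x (- F0' x / (F0 x * F0 x))%C).
  { intros x Hx; apply is_Cderive_inv; auto. }
  assert (Hq : forall x, q_f b f x = (f'' x / f x)%C) by reflexivity.
  assert (Da : forall x, D x -> is_derive_on D (fun s => f' s / f s)%C x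
       (q_f b f x - (f' x / f x) * (f' x / f x))%C).
  { intros x Hx; apply (is_derive_on_of_is_derive _ _ (fun s => F1 s * / F0 s)%C); trivial.
    - intros y Hy; rewrite (proj1 (A3 y Hy)), (proj1 (B3 y Hy)); reflexivity.
    - eapply is_Cderive_eq; [apply is_Cderive_mult; [apply B1 | now apply DI]|].
      rewrite Hq. destruct (A3 x Hx) as [-> ->], (B3 x Hx) as [-> ->].
      field; auto. }
  destruct (C1_extension b _ _ Hb Da) as (a & a' & C1 & C2 & C3).
  { apply (continuous_on_of_eq _ _ (fun x => F1' x * / F0 x + (- (1))
      * (F1 x * / F0 x * (F1 x * / F0 x)))%C).
    - intros x Hx; rewrite Hq. destruct (A3 x Hx) as [-> _]; destruct (B3 x Hx) as [-> ->].
      field; auto.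
    - intros x Hx. assert (I := is_Cderive_continuous _ _ _ (DI x Hx)).
      apply (continuous_plus (V := C_R_NormedModule)).
      + now apply (Ccontinuous_mult R_UniformSpace).
      + assert (I1 := is_Cderive_continuous _ _ _ (B1 x)).
        apply (Ccontinuous_mult R_UniformSpace); [apply continuous_const|].
        apply (Ccontinuous_mult R_UniformSpace); now apply (Ccontinuous_mult R_UniformSpace). }
  destruct (C1_extension b (fun x => / F0 x)%C (fun x => - F0' x / (F0 x * F0 x))%C Hb)
    as (G & G' & E1 & E2 & E3).
  { intros x Hx; apply (is_derive_on_of_is_derive _ _ (fun x => / F0 x)%C);
      trivial. now apply DI. }
  { apply (continuous_on_of_eq _ _ (fun x => (- (1)) * F0' x * (/ F0 x * / F0 x))%C).
    - intros x Hx; field; auto.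
    - intros x Hx. assert (I := is_Cderive_continuous _ _ _ (DI x Hx)).
      apply (Ccontinuous_mult R_UniformSpace); [|now apply (Ccontinuous_mult R_UniformSpace)].
      apply (Ccontinuous_mult R_UniformSpace); [apply continuous_const | apply A2]. }
  assert (A4 : forall x, D x -> a x = (f' x / f x)%C) by (intros x Hx; apply C3, Hx).
  exists a, a', F0, G.
  split; [exact C1|]. split; [exact C2|]. split; [exact A4|].
  split; [|split; [|split; [|split]]].
  - intros x Hx; destruct (C3 x Hx) as [-> ->]; ring.
  - intros x Hx; destruct (C3 x Hx) as [-> ->].
    unfold q_inv_f; fold D f'; ring.
  - intros x Hx; split; [now apply A3|].
    rewrite (proj1 (E3 x Hx)), (proj1 (A3 x Hx)); reflexivity.
  - intros x; split; eapply is_Cderive_continuous; [apply A1 | apply E1].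
  - intros x Hx; rewrite A4 by trivial; split.
    + eapply is_Cderive_eq; [apply A1|].
      destruct (A3 x Hx) as [-> ->]; field; auto.
    + eapply is_Cderive_eq; [apply E1|].
      destruct (E3 x Hx) as [-> ->]; destruct (A3 x Hx) as [-> ->]; field; auto.
Qed.

(** * The Darboux relations between the two solutions *)

(** Differentiating the two left-hand sides P and Q, the terms with a' cancel against those of the
    potentials, leaving P_v = a Q and Q_u = a P. *)
Lemma darboux_system (b : R) (a a' : R -> C) (K Ku Kv gK G Gu Gv gG : R -> R -> C) :
  0 < b -> mixed_primitive K Ku Kv gK -> mixed_primitive G Gu Gv gG ->
  (forall x, is_Cderive a x (a' x)) ->
  (forall u v, goursat_dom b u v -> gK u v = (a' (u + v)%R + a (u + v)%R * a (u + v)%R)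
    * K u v)%C ->
  (forall u v, goursat_dom b u v -> gG u v = (a (u + v)%R * a (u + v)%R - a' (u + v)%R)
    * G u v)%C ->
  (forall u, sym_itv b u -> Ku u 0 = / 2 * (a' u + a u * a u))%C ->
  (forall u, sym_itv b u -> Gu u 0 = / 2 * (a u * a u - a' u))%C ->
  (forall v, Kv 0 v = RtoC 0) -> (forall v, Gv 0 v = RtoC 0) ->
  (forall v, K 0 v = a 0%R / 2)%C -> (forall v, G 0 v = - a 0%R / 2)%C ->
  forall u v, goursat_dom b u v ->
    (Gu u v + Ku u v + a (u + v)%R * (G u v - K u v) = 0)%C /\
    (Gv u v - Kv u v + a (u + v)%R * (G u v + K u v) = 0)%C.
Proof.
  intros Hb HK HG Ha HgK HgG HKu HGu HKv HGv HK0 HG0.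
  assert (two : RtoC 2 <> RtoC 0) by (intros E; apply RtoC_inj in E; lra).
  assert (Hbnd : forall E, Ccontinuous2 E -> exists M, 0 <= M /\
     forall u v, goursat_dom b u v -> Cmod (E u v) <= M).
  { intros E HE; destruct (Ccontinuous2_bounded E b HE) as [M [HM1 HM2]].
    exists M; split; trivial. intros u v (H1 & H2 & _); auto. }
  destruct (Hbnd _ (mp_cont _ _ _ _ HK)) as (M1 & P1 & Q1).
  destruct (Hbnd _ (mp_cont_u _ _ _ _ HK)) as (M2 & P2 & Q2).
  destruct (Hbnd _ (mp_cont_v _ _ _ _ HK)) as (M3 & P3 & Q3).
  destruct (Hbnd _ (mp_cont _ _ _ _ HG)) as (M4 & P4 & Q4).
  destruct (Hbnd _ (mp_cont_u _ _ _ _ HG)) as (M5 & P5 & Q5).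
  destruct (Hbnd _ (mp_cont_v _ _ _ _ HG)) as (M6 & P6 & Q6).
  destruct (Hbnd (fun u _ => a u)) as (A & PA & QA).
  { apply Ccontinuous2_fst; intros x; exact (is_Cderive_continuous _ _ _ (Ha x)). }
  assert (QA' : forall x, sym_itv b x -> Cmod (a x) <= A).
  { intros x Hx; apply (QA x 0); repeat split; apply Rabs_le; unfold sym_itv in Hx; lra. }
  assert (Dshift : forall u v, is_Cderive (fun s => a (u + s)%R) v (a' (u + v)%R)).
  { intros u v; eapply is_Cderive_eq.
    - apply (is_derive_comp (V := C_R_NormedModule) a (fun s => u + s)); [apply Ha|].
      auto_derive; [trivial | reflexivity].
    - exact (scal_one (V := C_R_NormedModule) (a' (u + v))). }
  assert (Dshift' : forall u v, is_Cderive (fun s => a (s + v)%R) u (a' (u + v)%R)).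
  { intros u v; eapply is_Cderive_eq.
    - apply (is_derive_comp (V := C_R_NormedModule) a (fun s => s + v)); [apply Ha|].
      auto_derive; [trivial | reflexivity].
    - exact (scal_one (V := C_R_NormedModule) (a' (u + v))). }
  apply (goursat_system_zero b A (M2 + M5 + M3 + M6 + A * (M1 + M4)) a
    (fun u v => Gu u v + Ku u v + a (u + v)%R * (G u v - K u v))%C
    (fun u v => Gv u v - Kv u v + a (u + v)%R * (G u v + K u v))%C); trivial.
  - assert (0 <= A * (M1 + M4)) by (apply Rmult_le_pos; lra); lra.
  - intros u v Hd.
    assert (Cmod (G u v - K u v) <= M1 + M4).
    { unfold Cminus; eapply Rle_trans; [apply Cmod_triangle|]. rewrite Cmod_opp.
      specialize (Q1 _ _ Hd); specialize (Q4 _ _ Hd); lra. }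
    assert (Cmod (a (u + v)%R * (G u v - K u v)) <= A * (M1 + M4)).
    { rewrite Cmod_mult; apply Rmult_le_compat; try apply Cmod_ge_0; trivial.
      apply QA'; now apply (goursat_dom_axes b u v). }
    eapply Rle_trans; [apply Cmod_triangle|].
    assert (Hx := Cmod_triangle (Gu u v) (Ku u v)).
    specialize (Q2 _ _ Hd); specialize (Q5 _ _ Hd); lra.
  - intros u v Hd.
    assert (Cmod (G u v + K u v) <= M1 + M4).
    { eapply Rle_trans; [apply Cmod_triangle|].
      specialize (Q1 _ _ Hd); specialize (Q4 _ _ Hd); lra. }
    assert (Cmod (a (u + v)%R * (G u v + K u v)) <= A * (M1 + M4)).
    { rewrite Cmod_mult; apply Rmult_le_compat; try apply Cmod_ge_0; trivial.
      apply QA'; now apply (goursat_dom_axes b u v). }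
    eapply Rle_trans; [apply Cmod_triangle|].
    assert (Hx := Cmod_triangle (Gv u v) (- Kv u v)); rewrite Cmod_opp in Hx.
    specialize (Q3 _ _ Hd); specialize (Q6 _ _ Hd); unfold Cminus; lra.
  - intros u v Hd; eapply is_Cderive_eq.
    + apply is_Cderive_plus; [apply is_Cderive_plus;
        [apply (mp_uv _ _ _ _ HG) | apply (mp_uv _ _ _ _ HK)]|].
      apply (is_Cderive_mult (fun s => a (u + s)%R) (fun s => G u s - K u s)%C); [apply Dshift|].
      apply is_Cderive_minus; [apply (mp_v _ _ _ _ HG) | apply (mp_v _ _ _ _ HK)].
    + cbv beta; rewrite HgK, HgG by trivial; ring.
  - intros u v Hd; eapply is_Cderive_eq.
    + apply is_Cderive_plus; [apply is_Cderive_minus;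
        [apply (mp_vu _ _ _ _ HG) | apply (mp_vu _ _ _ _ HK)]|].
      apply (is_Cderive_mult (fun s => a (s + v)%R) (fun s => G s v + K s v)%C); [apply Dshift'|].
      apply is_Cderive_plus; [apply (mp_u _ _ _ _ HG) | apply (mp_u _ _ _ _ HK)].
    + cbv beta; rewrite HgK, HgG by trivial; ring.
  - intros u Hu.
    (* On the u-axis P equals a^2 + a (G - K), so it vanishes because G - K = - a there. *)
    assert (Z : (G u 0 - K u 0 + a u = 0)%C).
    { replace (RtoC 0) with (G 0%R 0%R - K 0%R 0%R + a 0%R)%C by (rewrite HG0,
        HK0; field; trivial).
      apply (constant_of_zero_derive_on (sym_itv b) (fun u => G u 0%R - K u 0%R + a u)%C);
        trivial.
      - apply convex_sym_itv.
      - intros s Hs; apply (is_derive_on_of_is_derive _ _ (fun u => G u 0%R - K u 0%R + a u)%C);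
          trivial.
        eapply is_Cderive_eq.
        + apply is_Cderive_plus; [apply is_Cderive_minus;
            [apply (mp_u _ _ _ _ HG) | apply (mp_u _ _ _ _ HK)] | apply Ha].
        + rewrite HKu, HGu by trivial; field; trivial.
      - unfold sym_itv; lra. }
    rewrite HKu, HGu by trivial; rewrite Rplus_0_r.
    replace (G u 0%R - K u 0%R)%C with (G u 0%R - K u 0%R + a u - a u)%C by ring.
    rewrite Z; field; trivial.
  - intros v Hv; rewrite HKv, HGv, HK0, HG0; field; trivial.
Qed.

(** * Kernels in characteristic and physical coordinates *)

(** Since x = u + v and t = u - v, differentiation in x is half the sum, and differentiation in t
    half the difference, of those in u and v. *)
Definition kernel_dx (Eu Ev : R -> R -> C) (x t : R) : C :=
  (/ 2 * (kernel_of Eu x t + kernel_of Ev x t))%C.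

Definition kernel_dt (Eu Ev : R -> R -> C) (x t : R) : C :=
  (/ 2 * (kernel_of Eu x t - kernel_of Ev x t))%C.

Lemma RtoC_half : RtoC (/ 2) = (/ 2)%C.
Proof. apply RtoC_inv; lra. Qed.

Lemma kernel_derive_x (E Eu Ev g : R -> R -> C) (x t : R) :
  mixed_primitive E Eu Ev g ->
  is_Cderive (fun s => kernel_of E s t) x (kernel_dx Eu Ev x t).
Proof.
  intros HE; eapply is_Cderive_eq.
  - apply (mixed_primitive_along E Eu Ev g (fun s => (s + t) / 2) (fun s => (s - t) / 2)
      x (/ 2) (/ 2) HE);
      auto_derive; trivial; field.
  - unfold kernel_dx, kernel_of; rewrite RtoC_half; ring.
Qed.

Lemma kernel_derive_t (E Eu Ev g : R -> R -> C) (x t : R) :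
  mixed_primitive E Eu Ev g ->
  is_Cderive (fun s => kernel_of E x s) t (kernel_dt Eu Ev x t).
Proof.
  intros HE; eapply is_Cderive_eq.
  - apply (mixed_primitive_along E Eu Ev g (fun s => (x + s) / 2) (fun s => (x - s) / 2)
      t (/ 2) (- / 2) HE);
      auto_derive; trivial; field.
  - unfold kernel_dt, kernel_of; rewrite RtoC_opp, RtoC_half; ring.
Qed.

Lemma kernel_of_continuous_t (F : R -> R -> C) (x t : R) :
  Ccontinuous2 F -> Ccontinuous (fun s => kernel_of F x s) t.
Proof.
  intros HF; apply (Ccontinuous2_along F (fun s => (x + s) / 2) (fun s => (x - s) / 2)); trivial;
    apply (ex_derive_continuous (V := R_NormedModule)); auto_derive; trivial.
Qed.

Lemma kernel_of_continuous_x (F : R -> R -> C) (x t : R) :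
  Ccontinuous2 F -> Ccontinuous (fun s => kernel_of F s t) x.
Proof.
  intros HF; apply (Ccontinuous2_along F (fun s => (s + t) / 2) (fun s => (s - t) / 2)); trivial;
    apply (ex_derive_continuous (V := R_NormedModule)); auto_derive; trivial.
Qed.

Lemma kernel_dom_of_le (b x t : R) : Rabs t <= Rabs x -> Rabs x <= b -> kernel_dom b x t.
Proof.
  intros H1 H2; assert (H3 := Rle_trans _ _ _ H1 H2); apply Rabs_le_between in H2, H3.
  repeat split; apply Rabs_le; lra.
Qed.

Lemma kernel_dom_convex1 (b t : R) : convex_set (fun s => kernel_dom b s t).
Proof.
  intros x y z (H1 & H2 & H3) (H4 & H5 & H6) Hz.
  apply Rabs_le_between in H1, H2, H3, H4, H5, H6.
  repeat split; apply Rabs_le; lra.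
Qed.

Lemma kernel_dom_convex2 (b x : R) : convex_set (fun s => kernel_dom b x s).
Proof.
  intros t y z (H1 & H2 & H3) (H4 & H5 & H6) Hz.
  apply Rabs_le_between in H1, H2, H3, H4, H5, H6.
  repeat split; apply Rabs_le; lra.
Qed.

(** For |t| <= b the horizontal slice of the kernel domain is all of [-b,b]; at x = b or x = -b the
    partial derivative is one-sided. *)
Lemma partial1_kernel (b : R) (K E Eu Ev g : R -> R -> C) (x t : R) :
  0 < b -> mixed_primitive E Eu Ev g ->
  (forall x t, kernel_dom b x t -> K x t = kernel_of E x t) ->
  Rabs t <= Rabs x -> Rabs x <= b ->
  partial1 (kernel_dom b) K x t = kernel_dx Eu Ev x t.
Proof.
  intros Hb HE HK Ht Hx.
  assert (Hd := kernel_dom_of_le b x t Ht Hx).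
  assert (Hz : exists z, kernel_dom b z t /\ z <> x).
  { assert (Ht' := Rle_trans _ _ _ Ht Hx); apply Rabs_le_between in Ht', Hx.
    destruct (Req_dec x b); [exists (-b) | exists b];
      (split; [repeat split; apply Rabs_le; lra | lra]). }
  destruct Hz as [z [Hz1 Hz2]].
  apply (Derive_on_unique _ _ x z); trivial; [apply kernel_dom_convex1|].
  apply (is_derive_on_of_is_derive _ _ (fun s => kernel_of E s t)); trivial.
  - intros y Hy; now apply HK.
  - now apply (kernel_derive_x E Eu Ev g).
Qed.

Lemma partial2_kernel_axis (b : R) (K E Eu Ev g : R -> R -> C) (x : R) :
  0 < b -> mixed_primitive E Eu Ev g ->
  (forall x t, kernel_dom b x t -> K x t = kernel_of E x t) ->
  Rabs x <= b -> partial2 (kernel_dom b) K x 0 = kernel_dt Eu Ev x 0.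
Proof.
  intros Hb HE HK Hx.
  assert (Hd : kernel_dom b x 0).
  { apply kernel_dom_of_le; trivial; rewrite Rabs_R0; apply Rabs_pos. }
  assert (Hz : kernel_dom b x b).
  { apply Rabs_le_between in Hx; repeat split; apply Rabs_le; lra. }
  apply (Derive_on_unique _ _ 0 b); trivial; [apply kernel_dom_convex2 | lra|].
  apply (is_derive_on_of_is_derive _ _ (fun s => kernel_of E x s)); trivial.
  - intros y Hy; now apply HK.
  - now apply (kernel_derive_t E Eu Ev g).
Qed.

Lemma Rabs_segment (x s : R) : Rmin 0 x <= s <= Rmax 0 x -> Rabs s <= Rabs x.
Proof.
  unfold Rmin, Rmax, Rabs; repeat destruct Rle_dec; repeat destruct Rcase_abs; lra.
Qed.

(** Two first integrals of the system: G + int_0^t K_x - a(x) int_0^t K is constant in t, and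
    F G + int_0^x F K_t is constant along the x-axis because (F G)_x = - F K_t there. *)
Lemma kernel_reconstruction (b : R) (a F : R -> C) (K Ku Kv gK G Gu Gv gG : R -> R ->
  C) (x t : R) :
  mixed_primitive K Ku Kv gK -> mixed_primitive G Gu Gv gG ->
  (forall s, Ccontinuous F s) ->
  (forall s, Rabs s <= b -> is_Cderive F s (a s * F s)%C) ->
  (forall s, Rabs s <= b -> F s <> RtoC 0) -> F 0 = RtoC 1 ->
  (forall x t, kernel_dom b x t ->
     kernel_dx Gu Gv x t = - a x * kernel_of G x t - kernel_dt Ku Kv x t)%C ->
  (forall x t, kernel_dom b x t ->
     kernel_dt Gu Gv x t = a x * kernel_of K x t - kernel_dx Ku Kv x t)%C ->
  Rabs t <= Rabs x -> Rabs x <= b ->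
  kernel_of G x t =
    (- (1 / F x) * CInt (fun eta => F eta * kernel_dt Ku Kv eta 0) 0 x
     - CInt (fun xi => kernel_dx Ku Kv x xi) 0 t
     + a x * CInt (fun xi => kernel_of K x xi) 0 t + G 0 0 / F x)%C.
Proof.
  intros HK HG CF DF Fn F0 Ex Et Ht Hx.
  assert (Cdx : forall s, Ccontinuous (fun xi => kernel_dx Ku Kv x xi) s).
  { intros s; apply (Ccontinuous_mult R_UniformSpace); [apply continuous_const|].
    apply (continuous_plus (V := C_R_NormedModule)); apply kernel_of_continuous_t; apply HK. }
  assert (CK : forall s, Ccontinuous (fun xi => kernel_of K x xi) s).
  { intros s; apply kernel_of_continuous_t, HK. }
  assert (Cdt : forall s, Ccontinuous (fun eta => F eta * kernel_dt Ku Kv eta 0)%C s).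
  { intros s; apply (Ccontinuous_mult R_UniformSpace); trivial.
    apply (Ccontinuous_mult R_UniformSpace); [apply continuous_const|].
    apply (continuous_minus (V := C_R_NormedModule)); apply kernel_of_continuous_x; apply HK. }
  assert (Z1 : (kernel_of G x t + CInt (fun xi => kernel_dx Ku Kv x xi) 0 t
            - a x * CInt (fun xi => kernel_of K x xi) 0 t = kernel_of G x 0)%C).
  { rewrite (constant_of_zero_derive (fun s => kernel_of G x s
       + CInt (fun xi => kernel_dx Ku Kv x xi) 0 s - a x * CInt (fun xi => kernel_of K x xi)
           0 s)%C t).
    - rewrite !CInt_point; ring.
    - intros s Hs; apply Rabs_segment in Hs.
      eapply is_Cderive_eq.
      + apply is_Cderive_minus; [apply is_Cderive_plus|].
        * apply (kernel_derive_t G Gu Gv gG x s HG).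
        * apply (is_Cderive_CInt _ 0 s Cdx).
        * apply (is_Cderive_mult (fun _ => a x) (fun s => CInt (fun xi => kernel_of K x xi) 0 s));
            [apply is_Cderive_const | apply (is_Cderive_CInt _ 0 s CK)].
      + cbv beta; rewrite Et; [ring|]. apply kernel_dom_of_le; trivial; lra. }
  assert (Z2 : (F x * kernel_of G x 0%R + CInt (fun eta => F eta * kernel_dt Ku Kv eta 0%R) 0 x
                = G 0%R 0%R)%C).
  { rewrite (constant_of_zero_derive (fun s => F s * kernel_of G s 0%R
       + CInt (fun eta => F eta * kernel_dt Ku Kv eta 0%R) 0 s)%C x).
    - rewrite CInt_point, F0; unfold kernel_of.
      replace ((0 + 0) / 2) with 0 by field; replace ((0 - 0) / 2) with 0 by field; ring.
    - intros s Hs; apply Rabs_segment in Hs.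
      eapply is_Cderive_eq.
      + apply is_Cderive_plus.
        * apply (is_Cderive_mult F (fun s => kernel_of G s 0)).
          -- apply DF; lra.
          -- apply (kernel_derive_x G Gu Gv gG s 0 HG).
        * apply (is_Cderive_CInt _ 0 s Cdt).
      + cbv beta; rewrite Ex; [ring|].
        apply kernel_dom_of_le; [rewrite Rabs_R0; apply Rabs_pos | lra]. }
  assert (Fx := Fn x Hx).
  replace (kernel_of G x t) with
    (kernel_of G x 0 - CInt (fun xi => kernel_dx Ku Kv x xi) 0 t
            + a x * CInt (fun xi => kernel_of K x xi) 0 t)%C by (rewrite <- Z1; ring).
  rewrite <- Z2; field; trivial.
Qed.

Theorem corollary7p2 (b : R) (f : R -> C) (Kf Kinvf : R -> R -> C)
    (hb : 0 < b)
    (hf : C2_on (sym_itv b) f)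
    (hf_neq0 : forall x : R, sym_itv b x -> f x <> 0%C)
    (hf0 : f 0 = 1%C)
    (hKf : is_kernel_f b f Kf)
    (hKinvf : is_kernel_inv_f b f Kinvf) :
  let f' := Derive_on (sym_itv b) f in
  forall x t : R, Rabs t <= Rabs x -> Rabs x <= b ->
    Kinvf x t =
      (- (1 / f x)
           * CInt (fun eta => f eta * partial2 (kernel_dom b) Kf eta 0) 0 x
       - CInt (fun xi => partial1 (kernel_dom b) Kf x xi) 0 t
       + f' x / f x * CInt (fun xi => Kf x xi) 0 t
       - f' 0%R / (2 * f x))%C
    /\
    Kf x t =
      (- f x
           * CInt (fun eta => 1 / f eta * partial2 (kernel_dom b) Kinvf eta 0) 0 x
       - CInt (fun xi => partial1 (kernel_dom b) Kinvf x xi) 0 t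
       - f' x / f x * CInt (fun xi => Kinvf x xi) 0 t
       + f' 0%R / 2 * f x)%C.
Proof.
  intros f' x t Ht Hx.
  assert (two : RtoC 2 <> RtoC 0) by (intros E; apply RtoC_inj in E; lra).
  destruct (log_derivative_extension b f hb hf hf_neq0)
    as (a & a' & F & Fi & Da & Ca' & Ea & Eq & Eqi & EF & CF & DF).
  assert (Ca : forall x, Ccontinuous a x)
    by (intros s; exact (is_Cderive_continuous _ _ _ (Da s))).
  assert (Cq : @continuous_on R_UniformSpace C_R_NormedModule (sym_itv b) (q_f b f)).
  { apply (continuous_on_of_eq _ _ (fun x => a' x + a x * a x)%C).
    - intros s Hs; symmetry; auto.
    - intros s _; apply (continuous_plus (V := C_R_NormedModule)); trivial.
      now apply (Ccontinuous_mult R_UniformSpace). }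
  assert (Cqi : @continuous_on R_UniformSpace C_R_NormedModule (sym_itv b) (q_inv_f b f)).
  { apply (continuous_on_of_eq _ _ (fun x => a x * a x - a' x)%C).
    - intros s Hs; symmetry; auto.
    - intros s _; apply (continuous_minus (V := C_R_NormedModule)); trivial.
      now apply (Ccontinuous_mult R_UniformSpace). }
  assert (H0 : sym_itv b 0) by (unfold sym_itv; lra).
  assert (Ea0 : a 0 = f' 0) by (rewrite Ea, hf0 by trivial; unfold f'; field).
  destruct hKf as (H & HH & HKf); destruct hKinvf as (H' & HH' & HKinvf).
  destruct (goursat_regular b _ _ _ hb Cq HH)
    as (K & Ku & Kv & gK & MK & EK & EgK & EKu & EKv & EK0).
  destruct (goursat_regular b _ _ _ hb Cqi HH')
    as (G & Gu & Gv & gG & MG & EG & EgG & EGu & EGv & EG0).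
  assert (HKf' : forall x t, kernel_dom b x t -> Kf x t = kernel_of K x t).
  { intros y s Hd; rewrite HKf by trivial; now apply EK. }
  assert (HKi' : forall x t, kernel_dom b x t -> Kinvf x t = kernel_of G x t).
  { intros y s Hd; rewrite HKinvf by trivial; now apply EG. }
  fold f' in EK0, EG0; rewrite <- Ea0 in EK0, EG0.
  assert (Sys := darboux_system b a a' K Ku Kv gK G Gu Gv gG hb MK MG Da).
  specialize (Sys ltac:(intros u v Hd; rewrite EgK,
    Eq; trivial; now apply (goursat_dom_axes b u v))
    ltac:(intros u v Hd; rewrite EgG, Eqi; trivial; now apply (goursat_dom_axes b u v))
    ltac:(intros u Hu; rewrite EKu, Eq by trivial; reflexivity)
    ltac:(intros u Hu; rewrite EGu, Eqi by trivial; reflexivity) EKv EGv EK0 EG0).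
  assert (Sum : forall x t, kernel_dom b x t ->
     (kernel_of Gu x t = - kernel_of Ku x t - a x * (kernel_of G x t - kernel_of K x t)
      /\ kernel_of Gv x t = kernel_of Kv x t - a x * (kernel_of G x t + kernel_of K x t))%C).
  { intros y s Hd; destruct (Sys _ _ Hd) as [S1 S2]; unfold kernel_of.
    replace ((y + s) / 2 + (y - s) / 2) with y in S1, S2 by field.
    generalize dependent ((y - s) / 2); generalize dependent ((y + s) / 2).
    intros u v S1 S2; split.
    - replace (Gu u v) with (Gu u v + Ku u v + a y * (G u v - K u v)
        - (Ku u v + a y * (G u v - K u v)))%C by ring.
      rewrite S1; ring.
    - replace (Gv u v) with (Gv u v - Kv u v + a y * (G u v + K u v)
        - (a y * (G u v + K u v) - Kv u v))%C by ring.
      rewrite S2; ring. }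
  assert (Hitv : forall s, Rabs s <= b -> sym_itv b s).
  { intros s Hs; now apply Rabs_le_between in Hs. }
  assert (Hseg : forall y s, Rmin 0 y < s < Rmax 0 y -> Rabs s <= Rabs y).
  { intros y s Hs; apply Rabs_segment; lra. }
  assert (Hfx := hf_neq0 x (Hitv x Hx)).
  rewrite HKf', HKi' by now apply kernel_dom_of_le.
  assert (Efx := Ea x (Hitv x Hx)); fold f' in Efx.
  split.
  - rewrite (kernel_reconstruction b a F K Ku Kv gK G Gu Gv gG x t MK MG); trivial.
    + rewrite (proj1 (EF x (Hitv x Hx))), EG0, Ea0, Efx.
      rewrite (CInt_ext _ (fun eta => f eta * partial2 (kernel_dom b) Kf eta 0%R)%C 0 x).
      2:{ intros s Hs; apply Hseg in Hs. rewrite (proj1 (EF s ltac:(apply Hitv; lra))).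
          rewrite (partial2_kernel_axis b Kf K Ku Kv gK); trivial; lra. }
      rewrite (CInt_ext (fun xi => kernel_dx Ku Kv x xi) (fun xi => partial1 (kernel_dom b)
        Kf x xi) 0 t).
      2:{ intros s Hs; apply Hseg in Hs.
          rewrite (partial1_kernel b Kf K Ku Kv gK); trivial; lra. }
      rewrite (CInt_ext (fun xi => kernel_of K x xi) (fun xi => Kf x xi) 0 t).
      2:{ intros s Hs; apply Hseg in Hs. symmetry; apply HKf', kernel_dom_of_le; lra. }
      field; auto.
    + apply CF.
    + intros s Hs; now apply DF, Hitv.
    + intros s Hs; rewrite (proj1 (EF s (Hitv s Hs))); apply hf_neq0, Hitv, Hs.
    + rewrite (proj1 (EF 0 H0)); exact hf0.
    + intros y s Hd; destruct (Sum y s Hd) as [S1 S2].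
      unfold kernel_dx, kernel_dt; rewrite S1, S2; field; trivial.
    + intros y s Hd; destruct (Sum y s Hd) as [S1 S2].
      unfold kernel_dx, kernel_dt; rewrite S1, S2; field; trivial.
  (* The symmetry of the system: the roles of K and G are exchanged, a becomes - a, f becomes 1/f. *)
  - rewrite (kernel_reconstruction b (fun s => - a s)%C Fi G Gu Gv gG K Ku Kv gK x t MG MK);
      trivial.
    + rewrite (proj2 (EF x (Hitv x Hx))), EK0, Ea0, Efx.
      rewrite (CInt_ext _ (fun eta => 1 / f eta * partial2 (kernel_dom b) Kinvf eta 0%R)%C 0 x).
      2:{ intros s Hs; apply Hseg in Hs. rewrite (proj2 (EF s ltac:(apply Hitv; lra))).
          rewrite (partial2_kernel_axis b Kinvf G Gu Gv gG); trivial; [|lra].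
          field. apply hf_neq0, Hitv; lra. }
      rewrite (CInt_ext (fun xi => kernel_dx Gu Gv x xi) (fun xi => partial1 (kernel_dom b)
        Kinvf x xi) 0 t).
      2:{ intros s Hs; apply Hseg in Hs.
          rewrite (partial1_kernel b Kinvf G Gu Gv gG); trivial; lra. }
      rewrite (CInt_ext (fun xi => kernel_of G x xi) (fun xi => Kinvf x xi) 0 t).
      2:{ intros s Hs; apply Hseg in Hs. symmetry; apply HKi', kernel_dom_of_le; lra. }
      field; auto.
    + apply CF.
    + intros s Hs; now apply DF, Hitv.
    + intros s Hs; rewrite (proj2 (EF s (Hitv s Hs))).
      intros E. assert (Hs' := hf_neq0 s (Hitv s Hs)).
      apply C1_nz. rewrite <- (Cinv_r (f s) Hs'), E; ring.
    + rewrite (proj2 (EF 0 H0)), hf0; field.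
    + intros y s Hd; destruct (Sum y s Hd) as [S1 S2].
      unfold kernel_dx, kernel_dt; rewrite S1, S2; field; trivial.
    + intros y s Hd; destruct (Sum y s Hd) as [S1 S2].
      unfold kernel_dx, kernel_dt; rewrite S1, S2; field; trivial.
Qed.
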